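(* Let $\alpha\in(1,2)$. Then, as $n\to\infty$, $$m_n=(1+o(1))\,H\,n^3\big(\bar F(\sqrt n)\big)^3,$$ with $$H=\frac{\alpha^3}{6}\int_0^\infty\int_0^\infty\int_0^\infty f_1(u,v,w)\,u^{-\alpha-1}v^{-\alpha-1}w^{-\alpha-1}\,du\,dv\,dw.$$ In particular, $m_n$ is regularly varying with index $3-\frac32\alpha$.
   Context: Model: let $W,W_1,W_2,\dots$ be i.i.d. non-negative random variables with continuous distribution function $F$ and $\bar F(x)=1-F(x)=\mathbb{P}(W>x)=x^{-\alpha}L(x)$ for $x>0$, where $L$ is slowly varying at infinity and $\alpha\in(1,2)$; $\mu=\mathbb{E}[W]$. The random graph has vertex set $\{1,\dots,n\}$; conditionally on the weights, each pair $i\ne j$ is connected by an edge independently with probability $\min(W_iW_j/(\mu n),1)$. $\triangle_n$ is the number of triangles in the graph and $m_n=\mathbb{E}[\triangle_n]$. For $n\ge1$, $$f_n(u,v,w)=\min\{uv/(\mu n),1\}\,\min\{vw/(\mu n),1\}\,\min\{uw/(\mu n),1\}.$$ A function $U$ is regularly varying with index $\rho$ if $U(\lambda x)/U(x)\to\lambda^\rho$ as $x\to\infty$ for every $\lambda>0$; a sequence $x_n$ is regularly varying if $t\mapsto x_{\lfloor t\rfloor}$ is. *)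

(* Defs.v *)
From HB Require Import structures.
From mathcomp Require Import all_boot all_order all_algebra.
From mathcomp Require Import all_classical all_reals all_analysis.

Set Implicit Arguments.
Unset Strict Implicit.
Unset Printing Implicit Defensive.

Import Order.TTheory GRing.Theory Num.Theory.
Import numFieldNormedType.Exports.

Local Open Scope classical_set_scope.
Local Open Scope ring_scope.

(* Since x / 0 = 0, the limit below forces U to be eventually nonzero. *)
Definition regularly_varying (R : realType) (U : R -> R) (rho : R) : Prop :=
  forall lambda : R, 0 < lambda ->
    U (lambda * x) / U x @[x --> +oo] --> lambda `^ rho.

Definition slowly_varying (R : realType) (L : R -> R) : Prop :=
  regularly_varying L 0.

(* [Num.truncn t] is the floor of [t] as a natural number, for [0 <= t]. *)
Definition regularly_varying_seq (R : realType) (u : nat -> R) (rho : R) : Prop :=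
  regularly_varying (fun t : R => u (Num.truncn t)) rho.

Section Probability.
Context d (T : measurableType d) (R : realType) (P : probability T R).

Definition mutually_independent (X : nat -> {RV P >-> R}) : Prop :=
  forall (s : seq nat) (B : nat -> set R), uniq s ->
    (forall i, measurable (B i)) ->
    P (\bigcap_(i in [set` s]) (X i @^-1` B i)) =
    (\prod_(i <- s) P (X i @^-1` B i))%E.

Definition identically_distributed (X : nat -> {RV P >-> R}) : Prop :=
  forall (i j : nat) (B : set R), measurable B ->
    P (X i @^-1` B) = P (X j @^-1` B).

Definition iid (X : nat -> {RV P >-> R}) : Prop :=
  mutually_independent X /\ identically_distributed X.

(* [Z] is a version of the conditional probability of the event [A] given the
   sub-sigma-algebra [G]. *)
Definition is_cond_probability (G : set (set T)) (A : set T) (Z : T -> R) : Prop :=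
  [/\ measurable A,
      forall B : set R, measurable B -> G (Z @^-1` B),
      P.-integrable [set: T] (EFin \o Z) &
      forall B : set T, G B -> (\int[P]_(w in B) (Z w)%:E = P (A `&` B))%E].

(* Conditionally on [G], the events [A i] for [i \in D] are independent and have
   probabilities [p i]; the case [S = [set i]] gives the individual
   probabilities. *)
Definition cond_independent_events (G : set (set T)) (I : finType) (D : {set I})
    (A : I -> set T) (p : I -> T -> R) : Prop :=
  forall S : {set I}, S \subset D ->
    is_cond_probability G (\bigcap_(i in [set` S]) A i)
                          (fun w => \prod_(i in S) p i w).

(* Generated by [X 0], ..., [X n.-1]. *)
Definition sigma_first (X : nat -> {RV P >-> R}) (n : nat) : set (set T) :=
  <<s \bigcup_(i in `I_n) preimage_set_system [set: T] (X i) measurable >>.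

(* [fine] sends infinite values to 0; a tail that is regularly varying of index
   below -1, with [X] nonnegative, makes the expectation finite. *)
Definition mean (X : {RV P >-> R}) : R := fine 'E_P[X].

Definition distribution_function (X : {RV P >-> R}) (x : R) : R :=
  fine (cdf X x).

Definition tail_function (X : {RV P >-> R}) (x : R) : R := fine (ccdf X x).

End Probability.

Definition edge_probability (R : realType) (mu : R) (n : nat) (u v : R) : R :=
  Num.min (u * v / (mu * n%:R)) 1.

Definition triangle_probability (R : realType) (mu : R) (n : nat) (u v w : R) : R :=
  edge_probability mu n u v * edge_probability mu n v w * edge_probability mu n u w.

(* The random graph on ['I_n] in which vertex [i] has weight [W i]; unordered
   pairs of vertices are represented by ordered pairs [(i, j)] with [i < j]. *)
Definition weighted_random_graph d (T : measurableType d) (R : realType)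
    (P : probability T R) (W : nat -> {RV P >-> R}) (n : nat)
    (g : T -> rel 'I_n) : Prop :=
  [/\ forall w, symmetric (g w),
      forall w, irreflexive (g w) &
      cond_independent_events P (sigma_first W n)
        [set e : 'I_n * 'I_n | (e.1 < e.2)%N]
        (fun e => [set w | g w e.1 e.2])
        (fun e w => edge_probability (mean (W 0%N)) n (W e.1 w) (W e.2 w))].

Definition triangles (n : nat) (e : rel 'I_n) : {set {set 'I_n}} :=
  [set t : {set 'I_n} | (#|t| == 3) &&
     [forall i in t, forall j in t, (i != j) ==> e i j]].

Definition expected_triangles d (T : measurableType d) (R : realType)
    (P : probability T R) (n : nat) (g : T -> rel 'I_n) : \bar R :=
  'E_P[fun w => #|triangles (g w)|%:R].

Definition triangle_constant (R : realType) (mu alpha : R) : \bar R :=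
  ((alpha ^+ 3 / 6)%:E *
   \int[lebesgue_measure]_(u in `]0%R, +oo[)
   \int[lebesgue_measure]_(v in `]0%R, +oo[)
   \int[lebesgue_measure]_(w in `]0%R, +oo[)
     (triangle_probability mu 1 u v w
      * u `^ (- alpha - 1) * v `^ (- alpha - 1) * w `^ (- alpha - 1))%:E)%E.

(* Main.v *)
From HB Require Import structures.
From mathcomp Require Import all_boot all_order all_algebra.
From mathcomp Require Import all_classical all_reals all_analysis.
From mathcomp Require Import measurable_realfun.
From mathcomp Require Import ring lra.
Require Import Defs.
Set Implicit Arguments.
Unset Strict Implicit.
Unset Printing Implicit Defensive.
Import Order.TTheory GRing.Theory Num.Theory.
Import numFieldNormedType.Exports.
Local Open Scope classical_set_scope.
Local Open Scope ring_scope.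

(* Write [S] for the tail of the weights, [s = sqrt n], and let [q_s] be the
   quantile function of [W / s], parametrized so that [x < q_s t] iff
   [t < S (s x) / S s].  Then [W / s] has, on the half-line, the law [S s] times
   the image of Lebesgue measure under [q_s], and scaling the weights by [s] turns
   [f_n] into [f_1], so that
     m_n = 'C(n, 3) (S s)^3 \int\int\int f_1 (q_s t1, q_s t2, q_s t3) dt1 dt2 dt3.
   As [s] grows, [q_s t] tends to [t^(- 1 / alpha)], which maps Lebesgue measure to
   the measure of density [alpha u^(- alpha - 1)]; dominated convergence yields [H].
   For the domination, [min (u v / mu, 1) <= (u v / mu)^theta] for every [theta] in
   [0, 1], so [f_1 (u, v, w)] is at most a constant times [u^a v^b w^c] whenever
   [a], [b], [c] are close enough to [alpha < 2]; choosing each exponent to be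
   [alpha - eps] or [alpha + eps] according to the size of the variable gives a
   product majorant, integrable by a Potter bound on [q_s].  Monotonicity of [S]
   replaces the uniform convergence theorem for regularly varying functions. *)

(** * Measures on the half-line with a given tail *)

(** Near 0 the limit measure of density alpha u^(- alpha - 1) has infinite mass, so uniqueness
    theorems for finite measures do not apply to it directly. The only data compared are the masses
    of rays away from 0, and this is enough because the kernel vanishes as soon as one weight is 0.
    Quantile functions put all scales on one fixed space, the Lebesgue cube, where convergence is
    pointwise and a single majorant serves for every large scale. The majorant is delicate: the
    natural choice, exponent alpha at each vertex (alpha / 2 on each edge, at most 1 since alpha <
    2), yields 1 / t in the quantile variable, which diverges at both ends. Shifting the exponent by
    eps on either side restores integrability, provided the Potter loss delta is smaller than eps.
    The bound alpha > 1 makes the mean finite. The limit integral must also be shown positive, both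
    for the factor 1 + o(1) to be defined by a quotient and for ratios of m_n to converge. *)

Section rays.
Context {R : realType}.
Implicit Types m : {measure set (measurableTypeR R) -> \bar R}.

(** The measures may be infinite near 0, so the pi-system argument runs on each truncation []a,
    +oo[], where the mass is finite; continuity from below along a = 1 / (n + 1) then recovers
    [A]. *)
Lemma eq_measure_rays m1 m2 :
  (forall x, 0 < x -> m1 `]x, +oo[%classic = m2 `]x, +oo[%classic) ->
  (forall x, 0 < x -> (m1 `]x, +oo[%classic < +oo)%E) ->
  forall A : set (measurableTypeR R), measurable A -> A `<=` `]0, +oo[%classic -> m1 A = m2 A.
Proof.
move=> m12 m1fin A mA A0.
have step (a : R) : 0 < a ->
    m1 (A `&` `]a, +oo[%classic) = m2 (A `&` `]a, +oo[%classic).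
  move=> a0.
  have ma : measurable (`]a, +oo[%classic : set (measurableTypeR R)) by exact: measurable_itv.
  have rayI (x y : R) : `]x, +oo[%classic `&` `]y, +oo[%classic
      = `]Num.max x y, +oo[%classic :> set R.
    by apply/seteqP; split => z /=; rewrite !in_itv/= !andbT gt_max => /andP.
  rewrite -[LHS]/(mrestr m1 ma A) -[RHS]/(mrestr m2 ma A).
  (* The generating rays may have negative endpoints; cut down to []a, +oo[], each becomes a ray at
     [Num.max x a > 0], where the hypotheses apply. *)
  apply: (@measure_unique _ R (measurableTypeR R) (@RGenOInfty.G R) (fun k => `]- k%:R, +oo[%classic)) => //.
  - exact: RGenOInfty.measurableE.
  - by move=> _ _ [x ->] [y ->]; exists (Num.max x y); exact: rayI.
  - by move=> k; exists (- k%:R).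
  - apply/seteqP; split => // x _ /=; exists (Num.truncn (- x)).+1 => //=.
    by rewrite in_itv/= andbT ltrNl truncnS_gt.
  - move=> _ [x ->]; rewrite /= /mrestr rayI.
    by apply: m12; rewrite lt_max a0 orbT.
  - move=> k; rewrite /= /mrestr rayI.
    by apply: m1fin; rewrite lt_max a0 orbT.
pose F n : set R := A `&` `](n.+1%:R)^-1, +oo[%classic.
have UF : \bigcup_n F n = A.
  rewrite -setI_bigcupr; apply/seteqP; split => [x []//|x Ax]; split => //.
  have := A0 _ Ax; rewrite /= in_itv/= andbT => x0.
  exists (Num.truncn x^-1) => //=.
  by rewrite in_itv/= andbT invf_plt ?posrE// truncnS_gt.
have mF n : measurable (F n) by apply: measurableI => //; exact: measurable_itv.
have ndF : {homo F : n m / (n <= m)%N >-> (n <= m)%O}.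
  move=> n m nm; apply/subsetPset; apply: setIS => x /=.
  rewrite !in_itv/= !andbT; apply: le_lt_trans.
  by rewrite lef_pV2 ?posrE// ler_nat.
have c (m : {measure set (measurableTypeR R) -> \bar R}) : m (F n) @[n --> \oo] --> m A.
  by rewrite -[in X in _ --> X]UF; apply: nondecreasing_cvg_mu => //; rewrite UF.
apply: (cvg_unique _ (c m1)) => //.
have -> : (fun n => m1 (F n)) = (fun n => m2 (F n)) by apply/funext => n; exact: step.
exact: c.
Qed.

Lemma ge0_integral_gt0E m (h : R -> \bar R) :
  (forall x, x <= 0 -> h x = 0%E) ->
  (\int[m]_x h x = \int[m]_(x in `]0%R, +oo[) h x)%E.
Proof.
move=> h0; rewrite [RHS]integral_mkcond; apply: eq_integral => x _.
rewrite patchE; case: ifPn => //.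
by rewrite notin_setE /= in_itv/= andbT => /negP; rewrite -leNgt => /h0.
Qed.

Lemma eq_integral_rays m1 m2 (h : R -> \bar R) :
  (forall x, 0 < x -> m1 `]x, +oo[%classic = m2 `]x, +oo[%classic) ->
  (forall x, 0 < x -> (m1 `]x, +oo[%classic < +oo)%E) ->
  (forall x, x <= 0 -> h x = 0%E) ->
  (\int[m1]_x h x = \int[m2]_x h x)%E.
Proof.
move=> m12 m1fin h0; rewrite !ge0_integral_gt0E//.
by apply: eq_measure_integral => A mA A0; exact: eq_measure_rays.
Qed.

End rays.

(** * Integration against a density *)

Section density.
Context d (T : measurableType d) (R : realType).
Context (mu : {measure set T -> \bar R}).
Context (rho : T -> R) (mrho : measurable_fun setT rho).
Context (rho0 : forall x, 0 <= rho x).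

(** The two proofs are carried as arguments so that the measure structure below can be attached to
    this very term. *)
Definition density_measure of measurable_fun setT rho & (forall x, 0 <= rho x) :=
  fun A : set T => (\int[mu]_(x in A) (rho x)%:E)%E.

Local Notation dm := (density_measure mrho rho0).

Let dm0 : dm set0 = 0%E. Proof. by rewrite /density_measure integral_set0. Qed.

Let dm_ge0 A : (0 <= dm A)%E.
Proof. by apply: integral_ge0 => x _; rewrite lee_fin. Qed.

Let dm_sigma_additive : semi_sigma_additive dm.
Proof.
move=> /= A mA tA mUA; rewrite /density_measure/= ge0_integral_bigcup//.
- by apply: is_cvg_ereal_nneg_natsum_cond => n _ _; exact: dm_ge0.
- exact/measurable_EFinP/measurable_funTS.
- by move=> x _; rewrite lee_fin.
Qed.

HB.instance Definition _ := isMeasure.Build _ _ _ dm dm0 dm_ge0 dm_sigma_additive.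

Import HBNNSimple.

Lemma ge0_integral_density (f : T -> \bar R) :
  measurable_fun setT f -> (forall x, 0 <= f x)%E ->
  (\int[dm]_x f x = \int[mu]_x (f x * (rho x)%:E))%E.
Proof.
move=> mf f0; pose f_ := nnsfun_approx measurableT mf.
have mfr n : measurable_fun setT (fun x => (f_ n x)%:E * (rho x)%:E)%E.
  by apply: emeasurable_funM; apply/measurable_EFinP.
transitivity (limn (fun n => \int[dm]_x (f_ n x)%:E))%E.
  rewrite -monotone_convergence//.
  - by apply: eq_integral => y _; apply/esym/cvg_lim => //; exact: cvg_nnsfun_approx.
  - by move=> n; exact/measurable_EFinP.
  - by move=> n y _; rewrite lee_fin.
  - by move=> y _ m n mn; rewrite lee_fin; exact/lefP/nd_nnsfun_approx.
transitivity (limn (fun n => \int[mu]_x ((f_ n x)%:E * (rho x)%:E)))%E; last first.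
  rewrite -monotone_convergence//.
  - apply: eq_integral => y _; apply/cvg_lim => //.
    by apply: cvgeZr => //; exact: cvg_nnsfun_approx.
  - by move=> n y _; rewrite mule_ge0 ?lee_fin.
  - move=> y _ m n mn; rewrite lee_wpmul2r ?lee_fin//.
    exact/lefP/nd_nnsfun_approx.
congr (limn _); apply/funext => n.
under [LHS]eq_integral => x _ do rewrite fimfunE -fsumEFin//.
rewrite [LHS]ge0_integral_fsum//; last 2 first.
- by move=> r; exact/measurable_EFinP/measurable_funM.
- by move=> r x _; rewrite nnfun_muleindic_ge0.
under [RHS]eq_integral => x _.
  rewrite fimfunE -fsumEFin// ge0_mule_fsuml; last first.
    by move=> r; rewrite nnfun_muleindic_ge0.
  over.
rewrite [RHS]ge0_integral_fsum//; last 2 first.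
- move=> r; apply: emeasurable_funM; apply/measurable_EFinP => //.
  exact: measurable_funM.
- by move=> r x _; rewrite mule_ge0 ?nnfun_muleindic_ge0 ?lee_fin.
apply: eq_fsbigr => r rr.
rewrite integralZl_indic_nnsfun// integral_indic//= setIT.
(* The sum ranges over real values; a negative one has empty preimage under a non-negative simple
   function. *)
have [r0|r0] := ltP r 0.
  rewrite preimage_nnfun0// measure0 mule0 integral0_eq// => x _.
  by rewrite indicE in_set0 mulr0 mul0e.
under eq_integral do rewrite EFinM -muleA.
rewrite ge0_integralZl//; last 2 first.
- by apply: emeasurable_funM; apply/measurable_EFinP.
- by move=> x _; rewrite mule_ge0 ?lee_fin.
congr (_ * _)%E; rewrite /density_measure integral_mkcond.
apply: eq_integral => x _; rewrite patchE indicE.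
by case: ifP; rewrite ?mul1e ?mul0e.
Qed.

End density.

(** * Generalized inverses of tails and the Pareto law *)

Section inverse_tail.
Context {R : realType}.
Variables (psi tail : R -> R).
Hypothesis psi_ge0 : forall t, 0 <= psi t.
Hypothesis psi_tail : forall x t, 0 <= x -> (x < psi t) = (0 < t < tail x).
Local Notation mu := (@lebesgue_measure R).

Lemma preimage_inverse_tail x :
  0 <= x -> psi @^-1` `]x, +oo[%classic = `]0, tail x[%classic.
Proof.
by move=> x0; apply/seteqP; split => t /=; rewrite !in_itv/= andbT psi_tail.
Qed.

Lemma measurable_inverse_tail : measurable_fun setT psi.
Proof.
apply: (measurability _ (RGenOInfty.measurableE R)).
move=> _ [_ [x ->] <-]; rewrite setTI; have [x0|x0] := leP 0 x.
  by rewrite preimage_inverse_tail//; exact: measurable_itv.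
rewrite (_ : _ @^-1` _ = setT)//; apply/seteqP; split => // t _ /=.
by rewrite in_itv/= andbT (lt_le_trans x0).
Qed.

(** [psi_tail] makes the preimage of a ray the interval []0, tail x[], whose length is the
    prescribed mass: [psi] transports Lebesgue measure to the measure with that tail. *)
Lemma lebesgue_inverse_tail x : 0 <= x -> 0 <= tail x ->
  mu (psi @^-1` `]x, +oo[%classic) = (tail x)%:E.
Proof.
move=> x0 Tx0; rewrite preimage_inverse_tail// lebesgue_measure_itv/= lte_fin.
by case: ltP => [_|Tx]; rewrite ?oppr0 ?adde0//; congr EFin; apply/eqP; rewrite eq_le Tx0.
Qed.

End inverse_tail.

Section pareto.
Context {R : realType} (alpha : R).
Hypothesis alpha0 : 0 < alpha.
Local Notation mu := (@lebesgue_measure R).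

Definition pareto_density (u : R) : R :=
  if 0 < u then alpha * u `^ (- alpha - 1) else 0.

(** The value 0 for [t <= 0] annihilates the kernel there, so integrals over the whole line only see
    the half-line. *)
Definition pareto_quantile (t : R) : R := if 0 < t then t `^ (- alpha^-1) else 0.

Lemma pareto_density_ge0 u : 0 <= pareto_density u.
Proof.
by rewrite /pareto_density; case: ifP => // _; rewrite mulr_ge0 ?powR_ge0// ltW.
Qed.

Lemma measurable_pareto_density : measurable_fun setT pareto_density.
Proof.
apply: measurable_fun_if => //.
- exact: measurable_fun_ltr.
- by apply: measurable_funTS; apply: measurable_funM => //; exact: measurable_powR.
Qed.

Lemma pareto_quantile_ge0 t : 0 <= pareto_quantile t.
Proof. by rewrite /pareto_quantile; case: ifP => // _; exact: powR_ge0. Qed.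

Lemma powR_lt_swap (x t : R) : 0 < x -> 0 < t ->
  (x < t `^ (- alpha^-1)) = (t < x `^ (- alpha)).
Proof.
move=> x0 t0; rewrite -ltr_ln ?posrE ?powR_gt0// -[RHS]ltr_ln ?posrE ?powR_gt0//.
rewrite !ln_powR mulNr mulrC -mulNr ltr_pdivlMr//.
by rewrite ltrNr mulrC mulNr.
Qed.

Lemma powR_gt_swap (x t : R) : 0 < x -> 0 < t ->
  (t `^ (- alpha^-1) < x) = (x `^ (- alpha) < t).
Proof.
move=> x0 t0; rewrite -ltr_ln ?posrE ?powR_gt0// -[RHS]ltr_ln ?posrE ?powR_gt0//.
rewrite !ln_powR mulNr mulrC -mulNr ltr_pdivrMr//.
by rewrite ltrNl mulrC mulNr.
Qed.

Lemma lt_pareto_quantile x t : 0 < x ->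
  (x < pareto_quantile t) = (0 < t < x `^ (- alpha)).
Proof.
move=> x0; rewrite /pareto_quantile; case: ifPn => [t0|]; last first.
  by move=> t0 /=; apply/negbTE; rewrite -leNgt ltW.
by rewrite powR_lt_swap.
Qed.

Lemma measurable_pareto_quantile : measurable_fun setT pareto_quantile.
Proof.
apply: measurable_fun_if => //.
- exact: measurable_fun_ltr.
- by apply: measurable_funTS; exact: measurable_powR.
Qed.

Lemma pareto_quantile_ray (x : R) : 0 < x ->
  mu (pareto_quantile @^-1` `]x, +oo[%classic) = (x `^ (- alpha))%:E.
Proof.
move=> x0; rewrite (_ : _ @^-1` _ = `]0, x `^ (- alpha)[%classic); last first.
  by apply/seteqP; split => t /=; rewrite !in_itv/= andbT lt_pareto_quantile.
by rewrite lebesgue_measure_itv/= lte_fin powR_gt0// oppr0 adde0.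
Qed.

Lemma cvgy_powRN (p : R) : 0 < p -> (x : R) `^ (- p) @[x --> +oo] --> 0.
Proof.
move=> p0; apply: (@cvg_trans _ ((expR (- p * ln x)) @[x --> +oo])).
  apply: near_eq_cvg; near=> x; rewrite /powR gt_eqF//.
apply/cvgrPdist_lt => e e0; near=> x.
rewrite sub0r normrN gtr0_norm ?expR_gt0//.
rewrite -[ltRHS]lnK ?posrE// ltr_expR mulNr ltrNl -ltr_pdivrMl//.
rewrite -[ltLHS]expRK ltr_ln ?posrE ?expR_gt0//.
Unshelve. all: by end_near. Qed.

Lemma pareto_density_ray (x : R) : 0 < x ->
  (\int[mu]_(u in `]x, +oo[) (pareto_density u)%:E = (x `^ (- alpha))%:E)%E.
Proof.
move=> x0; rewrite integral_itv_obnd_cbnd; last first.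
  apply/measurable_EFinP; apply: measurable_funTS; exact: measurable_pareto_density.
have dF (u : R) : 0 < u ->
    is_derive u 1 (fun u : R => - u `^ (- alpha)) (pareto_density u).
  move=> u0; rewrite /pareto_density u0 -[X in is_derive _ _ _ X]opprK.
  apply: is_deriveN; apply: is_derive_eq; first exact: is_derive1_powR.
  by rewrite mulNr.
have cF (p u : R) : 0 < u -> {for u, continuous (@powR R ^~ p)}.
  move=> u0; apply/differentiable_continuous/derivable1_diffP.
  by apply: derivable_powR; rewrite in_itv/= u0.
rewrite (@ge0_continuous_FTC2y _ _ (fun u : R => - u `^ (- alpha)) _ 0).
- by rewrite sub0e EFinN oppeK.
- by move=> u _; exact: pareto_density_ge0.
(* The density is given by cases; its continuity is checked on the ray only, where it coincides with
   a power function. *)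
- apply: (@subspace_eq_continuous _ _ _ (fun u : R => alpha * u `^ (- alpha - 1))).
    move=> u; rewrite /= mem_setE in_itv/= andbT => xu.
    by rewrite /from_subspace/= /pareto_density (lt_le_trans x0 xu).
  apply: continuous_in_subspaceT => u; rewrite mem_setE in_itv/= andbT => xu.
  apply: cvgM; first exact: cvg_cst.
  by apply: cF; exact: lt_le_trans xu.
- by rewrite -[X in _ --> X]oppr0; apply: cvgN; exact: cvgy_powRN.
- by move=> u xu; have [] := dF u (lt_trans x0 xu).
- by apply: cvg_at_right_filter; apply: cvgN; exact: cF.
- move=> u; rewrite in_itv/= andbT => xu.
  by rewrite derive1E; have [_ ->] := dF u (lt_trans x0 xu).
Qed.

End pareto.

(** * Triple integrals *)

Section triple_integral.
Local Open Scope ereal_scope.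
Context {R : realType}.
Local Notation mu := (@lebesgue_measure R).
Variables (m : {measure set (measurableTypeR R) -> \bar R}) (psi rho : R -> R).
Hypotheses (mpsi : measurable_fun [set: R] psi) (mrho : measurable_fun [set: R] rho).
Hypothesis rho0 : forall t, (0 <= rho t)%R.
Hypothesis rep : forall h : R -> \bar R, measurable_fun [set: R] h ->
  (forall x, 0 <= h x) -> \int[m]_x h x = \int[mu]_t (h (psi t) * (rho t)%:E).
Variable f : R * R * R -> \bar R.
Hypotheses (mf : measurable_fun [set: R * R * R] f) (f0 : forall p, 0 <= f p).

(** As [m] is not assumed sigma-finite, Fubini-Tonelli does not give measurability of its partial
    integrals. Replacing the innermost [m] by Lebesgue measure makes each partial integral
    measurable just before the next replacement. Having both [psi] and [rho] covers images (constant
    [rho]) and densities ([psi] the identity). *)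
Lemma triple_integral_transfer :
  \int[m]_x \int[m]_y \int[m]_z f (x, y, z) =
  \int[mu]_x \int[mu]_y \int[mu]_z
    (f (psi x, psi y, psi z) * (rho x * rho y * rho z)%:E).
Proof.
have mErho : measurable_fun [set: R] (EFin \o rho) by exact/measurable_EFinP.
pose F1 (q : (R * R) * R) := f (q.1, psi q.2) * (rho q.2)%:E.
have mF1 : measurable_fun [set: (R * R) * R] F1.
  apply: emeasurable_funM; last exact: (measurableT_comp mErho).
  apply: (measurableT_comp mf); apply: measurable_fun_pair => //.
  exact: (measurableT_comp mpsi).
have F10 q : 0 <= F1 q by rewrite mule_ge0 ?lee_fin.
pose g1 (p : R * R) := \int[mu]_z F1 (p, z).
have mg1 : measurable_fun [set: R * R] g1.
  exact: (@measurable_fun_fubini_tonelli_F _ _ (R * R)%type (measurableTypeR R) R mu F1 mF1 F10).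
have g10 p : 0 <= g1 p by exact: integral_ge0.
have g1E x y : \int[m]_z f (x, y, z) = g1 (x, y).
  rewrite rep//; apply: (measurableT_comp mf).
  exact: measurable_fun_pair.
pose F2 (q : R * R) := g1 (q.1, psi q.2) * (rho q.2)%:E.
have mF2 : measurable_fun [set: R * R] F2.
  apply: emeasurable_funM; last exact: (measurableT_comp mErho).
  apply: (measurableT_comp mg1); apply: measurable_fun_pair => //.
  exact: (measurableT_comp mpsi).
have F20 q : 0 <= F2 q by rewrite mule_ge0 ?lee_fin.
pose g2 (x : R) := \int[mu]_y F2 (x, y).
have mg2 : measurable_fun [set: R] g2.
  exact: (@measurable_fun_fubini_tonelli_F _ _ R (measurableTypeR R) R mu F2 mF2 F20).
have g20 p : 0 <= g2 p by exact: integral_ge0.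
have g2E x : \int[m]_y \int[m]_z f (x, y, z) = g2 x.
  under eq_integral do rewrite g1E.
  rewrite rep//; apply: (measurableT_comp mg1).
  exact: measurable_fun_pair.
under eq_integral do rewrite g2E.
rewrite rep//; apply: eq_integral => x _.
rewrite /g2 -ge0_integralZr ?lee_fin//; last first.
  by apply: (measurableT_comp mF2); exact: measurable_fun_pair.
apply: eq_integral => y _.
have mF1p p : measurable_fun [set: measurableTypeR R] (fun z => F1 (p, z)).
  by apply: (measurableT_comp mF1); exact: measurable_fun_pair.
rewrite /F2/= /g1 -ge0_integralZr ?lee_fin//.
rewrite -ge0_integralZr ?lee_fin//; last 2 first.
- exact: emeasurable_funM.
- by move=> z _; rewrite mule_ge0 ?lee_fin.
apply: eq_integral => z _.
by rewrite /F1/= -!muleA -!EFinM; congr (_ * _%:E)%E; rewrite mulrC [(rho y * _)%R]mulrC.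
Qed.

End triple_integral.

Section triple_integral_product.
Local Open Scope ereal_scope.
Context d (T : measurableType d) (R : realType).
Variable m : {sigma_finite_measure set T -> \bar R}.

Lemma sigma_finite_square : sigma_finite [set: T * T] (m \x m).
Proof.
have /sigma_finiteP[F [TF ndF Foo]] := sigma_finiteT m.
exists (fun n => F n `*` F n).
  apply/esym; rewrite -subTset => -[x y] _.
  have [/= i _ Fx] : (\bigcup_i F i) x by rewrite -TF.
  have [/= j _ Fy] : (\bigcup_i F i) y by rewrite -TF.
  exists (maxn i j) => //; split => /=.
  - by apply: (subsetPset _ _ (ndF _ _ (leq_maxl i j))).
  - by apply: (subsetPset _ _ (ndF _ _ (leq_maxr i j))).
move=> n; have [mF Fn] := Foo n; split; first exact: measurableX.
by rewrite product_measure1E// lte_mul_pinfty// ge0_fin_numE.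
Qed.

(* The library declares [m1 \x m2] sigma-finite only for subprobabilities. *)
Definition square_measure : {sigma_finite_measure set (T * T)%type -> \bar R} :=
  HB.pack_for {sigma_finite_measure set (T * T)%type -> \bar R} (m \x m)
    (Measure_isSigmaFinite.Build _ _ _ (m \x m) sigma_finite_square).

Lemma triple_integral_prod (f : T * T * T -> \bar R) :
  measurable_fun [set: T * T * T] f -> (forall p, 0 <= f p) ->
  \int[square_measure \x m]_p f p = \int[m]_x \int[m]_y \int[m]_z f (x, y, z).
Proof.
move=> mf f0; transitivity (\int[m \x m]_p fubini_F m f p).
  exact: (@fubini_tonelli1 _ _ (T * T)%type T R square_measure m f mf f0).
apply: (@fubini_tonelli1 _ _ T T R m m (fubini_F m f)).
- exact: (measurable_fun_fubini_tonelli_F f).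
- by move=> p; exact: integral_ge0.
Qed.

Lemma triple_integral_separated (K : R) (g : T -> R) :
  (0 <= K)%R -> measurable_fun [set: T] g -> (forall t, (0 <= g t)%R) ->
  \int[m]_t (g t)%:E \is a fin_num ->
  \int[square_measure \x m]_p (K * (g p.1.1 * g p.1.2 * g p.2))%:E =
  K%:E * (\int[m]_t (g t)%:E) * (\int[m]_t (g t)%:E) * (\int[m]_t (g t)%:E).
Proof.
move=> K0 mg g0; set I := \int[m]_t (g t)%:E => Ifin.
have I0 : 0 <= I by apply: integral_ge0 => t _; rewrite lee_fin.
have mEg : measurable_fun [set: T] (EFin \o g) by exact/measurable_EFinP.
have gE0 t : 0 <= (g t)%:E by rewrite lee_fin.
rewrite (triple_integral_prod (f := fun p => (K * (g p.1.1 * g p.1.2 * g p.2))%:E)); last 2 first.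
- apply/measurable_EFinP; apply: measurable_funM => //.
  apply: measurable_funM; last by apply: (measurableT_comp mg); exact: measurable_snd.
  apply: measurable_funM; apply: (measurableT_comp mg).
  + exact: (measurableT_comp measurable_fst).
  + exact: (measurableT_comp measurable_snd).
- by move=> p; rewrite lee_fin !mulr_ge0.
have inner x y : \int[m]_z (K * (g x * g y * g z))%:E = K%:E * (g x)%:E * (g y)%:E * I.
  rewrite -ge0_integralZl//; last by rewrite !mule_ge0.
  by apply: eq_integral => z _; rewrite -!EFinM; congr EFin; ring.
under eq_integral => x _ do under eq_integral => y _ do rewrite inner.
have middle x : \int[m]_y (K%:E * (g x)%:E * (g y)%:E * I) = K%:E * (g x)%:E * I * I.
  transitivity (\int[m]_y (K%:E * (g x)%:E * I * (g y)%:E)).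
    by apply: eq_integral => y _; rewrite muleAC.
  by rewrite ge0_integralZl// !mule_ge0.
under eq_integral => x _ do rewrite middle.
transitivity (\int[m]_x (K%:E * I * I * (g x)%:E)).
  by apply: eq_integral => x _; rewrite -(fineK Ifin) -!EFinM; congr EFin; ring.
by rewrite ge0_integralZl// !mule_ge0.
Qed.

End triple_integral_product.

(** * A Potter bound for monotone tails *)

Section potter.
Context {R : realType}.
Variables (S : R -> R) (alpha delta : R).
Hypothesis S_noninc : {homo S : x y /~ x <= y}.
Hypothesis S_gt0 : forall x, 0 < S x.
Hypothesis S_le1 : forall x, S x <= 1.
Hypothesis S_double : S (2 * x) / S x @[x --> +oo] --> 2 `^ (- alpha).
Hypothesis delta_range : 0 < delta < alpha.

Lemma dyadic_floor (z : R) : 1 <= z -> exists k, 2 ^+ k <= z < 2 ^+ k.+1.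
Proof.
move=> z1; have z0 : 0 <= z by exact: le_trans z1.
have n0 : (0 < Num.truncn z)%N by rewrite truncn_gt0.
exists (trunc_log 2 (Num.truncn z)); apply/andP; split.
  apply: (@le_trans _ _ (Num.truncn z)%:R); last by rewrite truncn_le.
  by rewrite -natrX ler_nat trunc_logP.
apply: lt_le_trans (truncnS_gt _) _.
by rewrite -natrX ler_nat trunc_log_ltn.
Qed.

Let a := alpha + delta.
Let b := alpha - delta.

Let b_gt0 : 0 < b. Proof. by rewrite subr_gt0; case/andP: delta_range. Qed.
Let ba : b <= a. Proof. by rewrite /a /b; case/andP: delta_range => ? ?; lra. Qed.
Let a_gt0 : 0 < a. Proof. exact: lt_le_trans ba. Qed.

(** Since [delta > 0], the limit 2^(- alpha) lies strictly between 2^(- a) and 2^(- b), so the limit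
    at the single ratio 2 gives both inequalities eventually. *)
Lemma doubling_bounds : exists2 x0, 0 < x0 &
  forall y, x0 <= y -> 2 `^ (- a) * S y <= S (2 * y) <= 2 `^ (- b) * S y.
Proof.
have [d0 da] := andP delta_range.
have lo : 2 `^ (- a) < 2 `^ (- alpha) :> R.
  by rewrite -ltr_ln ?posrE ?powR_gt0// !ln_powR ltr_pM2r ?ln_gt0 ?ltr1n// /a; lra.
have hi : 2 `^ (- alpha) < 2 `^ (- b) :> R.
  by rewrite -ltr_ln ?posrE ?powR_gt0// !ln_powR ltr_pM2r ?ln_gt0 ?ltr1n// /b; lra.
have [M [_ HM]] : \forall y \near +oo,
    2 `^ (- a) < S (2 * y) / S y < 2 `^ (- b).
  near=> y; apply/andP; split; near: y.
  - exact: (cvgr_gt _ S_double).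
  - exact: (cvgr_lt _ S_double).
exists (Num.max M 0 + 1); first by rewrite ltr_wpDl// le_max lexx orbT.
move=> y My; have /HM /andP[] : M < y.
  by apply: lt_le_trans My; rewrite (@le_lt_trans _ _ (Num.max M 0)) ?le_max ?lexx// ltrDl.
by rewrite ltr_pdivlMr// ltr_pdivrMr// => /ltW -> /ltW ->.
Unshelve. all: by end_near. Qed.

Lemma iterated_doubling_bounds x0 : 0 < x0 ->
  (forall y, x0 <= y -> 2 `^ (- a) * S y <= S (2 * y) <= 2 `^ (- b) * S y) ->
  forall k y, x0 <= y ->
    (2 ^+ k) `^ (- a) * S y <= S (2 ^+ k * y) <= (2 ^+ k) `^ (- b) * S y.
Proof.
move=> x00 H k y xy; elim: k => [|k /andP[IH1 IH2]].
  by rewrite expr0 !powR1 !mul1r lexx.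
have /H/andP[H1 H2] : x0 <= 2 ^+ k * y.
  by rewrite (le_trans xy)// ler_peMl ?(le_trans (ltW x00))// exprn_ege1// ler1n.
rewrite exprS -mulrA !powRM ?exprn_ge0// -!mulrA; apply/andP; split.
- by apply: le_trans H1; rewrite ler_wpM2l ?powR_ge0.
- by apply: (le_trans H2); rewrite ler_wpM2l ?powR_ge0.
Qed.

Lemma powRN_anti (p x y : R) : 0 <= p -> 0 < x -> x <= y -> y `^ (- p) <= x `^ (- p).
Proof.
move=> p0 x0 xy; rewrite !powRN lef_pV2 ?posrE ?powR_gt0//; last exact: lt_le_trans xy.
by apply: ge0_ler_powR => //; rewrite nnegrE ltW// (lt_le_trans x0).
Qed.

(** The bound is wanted for every [x > 0], however small [s * x] is, because it must control the
    quantile on the whole half-line. The exponent [a] governs [x < 1] and [b] governs [x >= 1]. *)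
Lemma potter_bound : exists C x0, [/\ 0 < C, 0 < x0 &
  forall s x, x0 <= s -> 0 < x ->
    S (s * x) <= C * S s * Num.max (x `^ (- a)) (x `^ (- b))].
Proof.
have [x0 x00 /(iterated_doubling_bounds x00) H] := doubling_bounds.
(* Rounding [z] up to a power of 2, which is at most [2 * z], costs the factor 2^a. *)
have lower y z : x0 <= y -> 1 <= z -> S y <= 2 `^ a * z `^ a * S (z * y).
  move=> xy z1; have [k /andP[kz zk]] := dyadic_floor z1.
  have y0 : 0 < y by exact: lt_le_trans xy.
  have z0 : 0 < z by exact: lt_le_trans z1.
  rewrite -ler_pdivrMl ?mulr_gt0 ?powR_gt0//.
  have /andP[+ _] := H k.+1 y xy; move=> H1.
  apply: (@le_trans _ _ (S (2 ^+ k.+1 * y))); last first.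
    by apply: S_noninc; rewrite ler_wpM2r// ltW.
  apply: le_trans H1; rewrite ler_wpM2r ?(ltW (S_gt0 _))//.
  rewrite -powRM// ?(ltW z0)// -powRN; apply: powRN_anti; first exact: ltW.
    by rewrite exprn_gt0.
  by rewrite exprS ler_wpM2l.
(* Rounding [z] down to a power of 2, which exceeds [z / 2], costs the factor 2^b. *)
have upper y z : x0 <= y -> 1 <= z -> S (z * y) <= 2 `^ b * z `^ (- b) * S y.
  move=> xy z1; have [k /andP[kz zk]] := dyadic_floor z1.
  have y0 : 0 < y by exact: lt_le_trans xy.
  have z0 : 0 < z by exact: lt_le_trans z1.
  have /andP[_ H1] := H k y xy.
  apply: (@le_trans _ _ (S (2 ^+ k * y))).
    by apply: S_noninc; rewrite ler_wpM2r// ltW.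
  apply: (le_trans H1); rewrite ler_wpM2r ?(ltW (S_gt0 _))//.
  have -> : 2 `^ b * z `^ (- b) = (z / 2) `^ (- b).
    by rewrite powRM ?invr_ge0// ?(ltW z0)// -powR_inv1// -powRrM mulN1r opprK mulrC.
  apply: powRN_anti; rewrite ?(ltW b_gt0) ?divr_gt0//.
  by rewrite ler_pdivrMr// -exprSr ltW.
(* One constant absorbs both rounding factors, since [S x0 <= 1] and [b <= a]. *)
have C1 : 2 `^ a <= 2 `^ a / S x0.
  by rewrite ler_peMr ?powR_ge0// invf_ge1.
have C2 : 2 `^ b <= 2 `^ a / S x0.
  by apply: le_trans C1; apply: ler_powR => //; rewrite ler1n.
have Sge0 y : 0 <= S y by exact: ltW.
exists (2 `^ a / S x0), x0; split => //; first by rewrite divr_gt0 ?powR_gt0.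
move=> s x xs x_gt0; have s0 : 0 < s by exact: lt_le_trans xs.
have [x1|x1] := leP 1 x.
  rewrite mulrC; apply: (le_trans (upper _ _ xs x1)).
  rewrite mulrAC ler_pM ?mulr_ge0 ?powR_ge0//; last by rewrite le_max lexx orbT.
  by rewrite ler_wpM2r.
have ix1 : 1 <= x^-1 by rewrite invf_ge1// ltW.
have ixa : x^-1 `^ a = x `^ (- a).
  by rewrite -powR_inv1 ?(ltW x_gt0)// -powRrM mulN1r.
apply: (@le_trans _ _ (2 `^ a / S x0 * S s * x `^ (- a))); last first.
  by rewrite ler_wpM2l ?le_max ?lexx// !mulr_ge0 ?powR_ge0// invr_ge0.
have [sx|sx] := leP x0 (s * x).
  apply: (le_trans (lower _ _ sx ix1)).
  rewrite [s * x]mulrC mulKf ?gt_eqF// ixa mulrAC ler_wpM2r ?powR_ge0//.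
  by rewrite ler_wpM2r.
(* Here [s * x < x0], where only [S <= 1] is available; the lower bound on [S s]
   costs the factor [(S x0)^-1] in the constant. *)
apply: (le_trans (S_le1 _)).
have s1 : 1 <= s / x0 by rewrite ler_pdivlMr// mul1r.
have := lower _ _ (lexx x0) s1; rewrite divfK ?gt_eqF// => H1.
rewrite mulrAC [_ / S x0]mulrC -!mulrA ler_pdivlMl// mulr1.
apply: (le_trans H1); rewrite [leRHS]mulrA ler_wpM2r//.
rewrite ler_wpM2l ?powR_ge0// -ixa; apply: ge0_ler_powR => //.
- exact: ltW.
- by rewrite nnegrE divr_ge0 ?ltW.
- by rewrite nnegrE invr_ge0 ltW.
- by rewrite ler_pdivrMr// ler_pdivlMl// mulrC ltW.
Qed.

End potter.

(** * Scaled quantile functions *)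

Definition tail_quantile {R : realType} (S : R -> R) (u : R) : R :=
  sup [set x | u < S x].

(* Quantile function of the law with tail [S], observed at scale [s]: the map
   sending Lebesgue measure on the half-line to the measure with tail
   [x |-> S (s * x) / S s]. *)
Definition scaled_quantile {R : realType} (S : R -> R) (s t : R) : R :=
  if 0 < t then tail_quantile S (t * S s) / s else 0.

Section quantile.
Context {R : realType}.
Variable S : R -> R.
Hypothesis S_noninc : {homo S : x y /~ x <= y}.
Hypothesis S_gt0 : forall x, 0 < S x.
Hypothesis S_le1 : forall x, S x <= 1.
Hypothesis S_neg : forall x, x < 0 -> S x = 1.
Hypothesis S_right : forall x, S y @[y --> x^'+] --> S x.
Hypothesis S_cvg0 : S x @[x --> +oo] --> 0.

Lemma tail_quantile_ubound u : 0 < u -> has_ubound [set x | u < S x].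
Proof.
move=> u0; have [M [_ HM]] := cvgr_lt _ S_cvg0 _ u0.
exists M => x /= ux; rewrite leNgt; apply/negP => /HM /=.
by rewrite ltNge (ltW ux).
Qed.

(** Right continuity makes the equivalence exact: if [u < S x], the inequality persists at some
    [y > x], so the supremum passes [x] strictly. *)
Lemma lt_tail_quantile (u x : R) : 0 < u -> 0 <= x -> (x < tail_quantile S u) = (u < S x).
Proof.
move=> u0 x0; rewrite /tail_quantile; have [u1|u1] := ltP u 1; last first.
  (* For [u >= 1] the set is empty and [sup] takes its default value 0, so both sides are false. *)
  rewrite (_ : [set _ | _] = set0).
    by rewrite sup0 !ltNge x0 (le_trans (S_le1 x) u1).
  by apply/seteqP; split => // y /=; rewrite ltNge (le_trans (S_le1 y) u1).
have ub := tail_quantile_ubound u0; apply/idP/idP => [|ux].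
  (* [-1] shows that the set is non-empty: there [S] equals 1, and [u < 1]. *)
  move=> /sup_gt; case; first by exists (-1); rewrite /= S_neg// ltrN10.
  by move=> y /= uy /ltW xy; apply: lt_le_trans uy _; exact: S_noninc.
have near_x : \forall y \near x^'+, u < S y /\ x < y.
  by near do split; [exact: (cvgr_gt _ (@S_right x))|exact: nbhs_right_gt].
have [y [/= uy xy]] := @filter_ex _ _ (at_right_proper_filter x) _ near_x.
by apply: (lt_le_trans xy); exact: ub_le_sup.
Unshelve. all: by end_near. Qed.

Lemma tail_quantile_ge0 u : 0 < u -> 0 <= tail_quantile S u.
Proof.
move=> u0; rewrite /tail_quantile; have [u1|u1] := ltP u 1; last first.
  rewrite (_ : [set _ | _] = set0) ?sup0//.
  by apply/seteqP; split => // y /=; rewrite ltNge (le_trans (S_le1 y) u1).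
rewrite leNgt; apply/negP => Q0.
(* Were the supremum negative, its half would be larger and still negative, hence a point of the
   set. *)
suff : sup [set x | u < S x] / 2 <= sup [set x | u < S x] by lra.
apply: ub_le_sup; first exact: tail_quantile_ubound.
by rewrite /= S_neg// ltr_pdivrMr// mul0r.
Qed.

Lemma scaled_quantile_ge0 s t : 0 < s -> 0 <= scaled_quantile S s t.
Proof.
move=> s0; rewrite /scaled_quantile; case: ifPn => // t0.
by rewrite divr_ge0 ?(ltW s0)// tail_quantile_ge0// mulr_gt0.
Qed.

Lemma lt_scaled_quantile s x t : 0 < s -> 0 <= x ->
  (x < scaled_quantile S s t) = (0 < t < S (s * x) / S s).
Proof.
move=> s0 x0; rewrite /scaled_quantile; case: ifPn => [t0|]; last first.
  by move=> _ /=; apply/negbTE; rewrite -leNgt.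
rewrite ltr_pdivlMr// lt_tail_quantile ?mulr_gt0 ?mulr_ge0// ?(ltW s0)//.
by rewrite ltr_pdivlMr// [x * s]mulrC.
Qed.

(** The limit tail is strictly decreasing, so points just below and just above the limit quantile
    have limit tails strictly on either side of [t]. The scaled tails inherit these strict
    inequalities, and [lt_scaled_quantile] turns them back into bounds on the quantile. *)
Lemma cvg_scaled_quantile (alpha t : R) : 0 < alpha ->
  (forall x, 0 < x -> S (s * x) / S s @[s --> +oo] --> x `^ (- alpha)) ->
  scaled_quantile S s t @[s --> +oo] --> pareto_quantile alpha t.
Proof.
move=> alpha0 HS; have [t0|t0] := ltP 0 t; last first.
  have -> : (fun s => scaled_quantile S s t) = cst 0.
    by apply/funext => s; rewrite /scaled_quantile ltNge t0.
  by rewrite /pareto_quantile ltNge t0/=; exact: cvg_cst.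
have p0 : 0 < pareto_quantile alpha t by rewrite /pareto_quantile t0 powR_gt0.
apply/cvgrPdist_lt => e e0.
(* The second term keeps [lo] positive, as convergence of the tail ratios is only given at positive
   points. *)
pose lo := Num.max (pareto_quantile alpha t - e / 2) (pareto_quantile alpha t / 2).
pose hi := pareto_quantile alpha t + e / 2.
have lo0 : 0 < lo by rewrite lt_max divr_gt0 ?orbT.
have lop : lo < pareto_quantile alpha t by rewrite gt_max; lra.
have php : pareto_quantile alpha t < hi by rewrite /hi; lra.
have hi0 : 0 < hi by exact: lt_trans php.
have tlo : t < lo `^ (- alpha) by move: lop; rewrite lt_pareto_quantile// t0.
have thi : hi `^ (- alpha) < t.
  by move: php; rewrite [ltLHS]/pareto_quantile t0 powR_gt_swap.
near=> s.
have s0 : 0 < s by near: s; exact: nbhs_pinfty_gt.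
have H1 : lo < scaled_quantile S s t.
  rewrite lt_scaled_quantile ?(ltW lo0)// t0/=; near: s.
  exact: (cvgr_gt _ (HS _ lo0)).
have H2 : scaled_quantile S s t <= hi.
  rewrite leNgt lt_scaled_quantile ?(ltW hi0)// t0/= -leNgt; apply: ltW; near: s.
  exact: (cvgr_lt _ (HS _ hi0)).
have : pareto_quantile alpha t - e / 2 <= lo by rewrite le_max lexx.
move: H1 H2; rewrite ltr_norml /hi => H1 H2 H3.
by apply/andP; split; lra.
Unshelve. all: by end_near. Qed.

End quantile.

(** * An integrable majorant *)

Section triangle_probability_bound.
Context {R : realType}.
Implicit Types (mu theta alpha eps : R).

Lemma minr1_powR (w theta : R) : 0 <= w -> 0 <= theta <= 1 ->
  Num.min w 1 <= w `^ theta.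
Proof.
move=> w0 /andP[t0 t1]; have [->|w_neq0] := eqVneq w 0.
  by rewrite min_l// powR_ge0.
have w_gt0 : 0 < w by rewrite lt_def w_neq0.
have [w1|w1] := leP w 1; first by apply: ger1_powR => //; rewrite w_gt0.
by rewrite -(powRr0 w); apply: ler_powR => //; exact: ltW.
Qed.

Lemma edge_probability_ge0 mu n u v :
  0 < mu -> 0 <= u -> 0 <= v -> 0 <= edge_probability mu n u v.
Proof.
by move=> mu0 u0 v0; rewrite le_min ler01 andbT divr_ge0 ?mulr_ge0// ltW.
Qed.

(** The factor [Num.max 1 mu^-1] dominates mu^(- theta) for all [theta] in [0, 1] at once, so the
    constant does not depend on the exponents chosen later. *)
Lemma edge_probability_powR mu theta u v :
  0 < mu -> 0 <= theta <= 1 -> 0 <= u -> 0 <= v ->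
  edge_probability mu 1 u v <= Num.max 1 mu^-1 * (u `^ theta * v `^ theta).
Proof.
move=> mu0 t01 u0 v0; rewrite /edge_probability mulr1.
apply: (le_trans (minr1_powR _ t01)); first by rewrite !mulr_ge0// invr_ge0 ltW.
rewrite !powRM ?mulr_ge0 ?invr_ge0 ?(ltW mu0)// mulrC.
rewrite ler_wpM2r ?mulr_ge0 ?powR_ge0//.
have imu0 : 0 < mu^-1 by rewrite invr_gt0.
have [t0 t1] := andP t01.
rewrite le_max; have [mu1|mu1] := leP 1 mu^-1.
  by rewrite ler1_powR ?orbT.
apply/orP; left; rewrite -(powRr0 mu^-1); apply: ger_powR => //.
by rewrite imu0 ltW.
Qed.

(** The two conditions on [3 * eps] say that the edge exponents, which lie within [3 * eps / 2] of
    [alpha / 2], stay in [0, 1]. *)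
Lemma triangle_probability_powR mu alpha eps a b c u v w :
  0 < mu -> 3 * eps <= alpha -> alpha + 3 * eps <= 2 -> 0 < eps ->
  `|a - alpha| <= eps -> `|b - alpha| <= eps -> `|c - alpha| <= eps ->
  0 <= u -> 0 <= v -> 0 <= w ->
  triangle_probability mu 1 u v w
    <= Num.max 1 mu^-1 ^+ 3 * (u `^ a * v `^ b * w `^ c).
Proof.
move=> mu0 ale agt e0; rewrite !ler_norml => /andP[a1 a2] /andP[b1 b2] /andP[c1 c2].
move=> u0 v0 w0; set K := Num.max _ _.
(* The exponents [tuv], [tvw], [tuw] of the three edges are chosen so that those
   meeting a vertex add up to [a], [b], [c]. *)
pose tuv := (a + b - c) / 2; pose tvw := (b + c - a) / 2; pose tuw := (a + c - b) / 2.
have split_powR (x p q r : R) : p = q + r -> 0 < p -> x `^ p = x `^ q * x `^ r.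
  by move=> -> p0; rewrite powRD// (gt_eqF p0).
rewrite (split_powR u a tuv tuw); [|by rewrite /tuv /tuw; lra|lra].
rewrite (split_powR v b tuv tvw); [|by rewrite /tuv /tvw; lra|lra].
rewrite (split_powR w c tvw tuw); [|by rewrite /tuw /tvw; lra|lra].
rewrite (_ : K ^+ 3 * _ = K * (u `^ tuv * v `^ tuv) * (K * (v `^ tvw * w `^ tvw))
  * (K * (u `^ tuw * w `^ tuw))); last by ring.
rewrite /triangle_probability !ler_pM ?mulr_ge0 ?edge_probability_ge0//;
  apply: edge_probability_powR => //; rewrite /tuv /tvw /tuw; lra.
Qed.

Definition vertex_weight alpha eps (x : R) : R :=
  Num.min (x `^ (alpha - eps)) (x `^ (alpha + eps)).

(** Each minimum equals one of its two powers, and the power bound allows the exponents at the three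
    vertices to be picked independently. *)
Lemma triangle_probability_le_prod mu alpha eps u v w :
  0 < mu -> 3 * eps <= alpha -> alpha + 3 * eps <= 2 -> 0 < eps ->
  0 <= u -> 0 <= v -> 0 <= w ->
  triangle_probability mu 1 u v w <= Num.max 1 mu^-1 ^+ 3 *
    (vertex_weight alpha eps u * vertex_weight alpha eps v * vertex_weight alpha eps w).
Proof.
move=> mu0 ale agt e0 u0 v0 w0.
have weightE x : exists2 a, `|a - alpha| <= eps & vertex_weight alpha eps x = x `^ a.
  rewrite /vertex_weight; case: leP => _.
    by exists (alpha - eps) => //; rewrite ler_norml; apply/andP; split; lra.
  by exists (alpha + eps) => //; rewrite ler_norml; apply/andP; split; lra.
have [a ha ->] := weightE u; have [b hb ->] := weightE v; have [c hc ->] := weightE w.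
exact: (@triangle_probability_powR mu alpha eps).
Qed.

End triangle_probability_bound.

Section dominating_function.
Context {R : realType}.
Variables (alpha eps delta C : R).
Hypothesis eps_gt0 : 0 < eps.
Hypothesis eps_lt : eps < alpha.
Hypothesis delta_range : 0 < delta < eps.
Hypothesis C_gt0 : 0 < C.

Let a := alpha + delta.
Let b := alpha - delta.

(** This inverts the Potter bound: at the claimed upper bound [D], the scaled tail is already at
    most [t], so the quantile cannot exceed [D]. *)
Lemma scaled_quantile_le (S : R -> R) s t :
  (forall x, 0 < S x) ->
  (forall x, 0 < x -> S (s * x) <= C * S s * Num.max (x `^ (- a)) (x `^ (- b))) ->
  (forall x, 0 <= x -> (x < scaled_quantile S s t) = (0 < t < S (s * x) / S s)) ->
  0 < t ->
  scaled_quantile S s t <= Num.max ((t / C) `^ (- a^-1)) ((t / C) `^ (- b^-1)).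
Proof.
move=> S0 H lt_q t0; have [d0 de] := andP delta_range; have e0 := eps_gt0; have ea := eps_lt.
have a0 : 0 < a by rewrite /a; lra.
have b0 : 0 < b by rewrite /b; lra.
set D := Num.max _ _.
have tC : 0 < t / C by rewrite divr_gt0.
have D0 : 0 < D by rewrite lt_max powR_gt0.
rewrite leNgt lt_q ?(ltW D0)// t0/= -leNgt.
rewrite ler_pdivrMr//; apply: (le_trans (H _ D0)).
rewrite mulrAC ler_wpM2r ?(ltW (S0 _))// mulrC -ler_pdivlMr//.
have inv_pow p : 0 < p -> (t / C) `^ (- p^-1) <= D -> D `^ (- p) <= t / C.
  move=> p0 HD; have -> : t / C = ((t / C) `^ (- p^-1)) `^ (- p).
    by rewrite -powRrM mulrNN mulVf ?gt_eqF// powRr1 ?ltW.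
  by apply: powRN_anti => //; [exact: ltW|exact: powR_gt0].
by rewrite ge_max !inv_pow// le_max lexx ?orbT.
Qed.

(** The exponents come from composing [vertex_weight] with the inverted Potter bound. As
    [delta < eps], (alpha - eps) / b < 1 gives integrability at 0 and (alpha + eps) / a > 1 at
    infinity; at [t = C] the larger of the two powers in the quantile bound changes. *)
Definition weight_bound (t : R) : R :=
  if 0 < t then
    if t <= C then (t / C) `^ (- ((alpha - eps) / b))
    else (t / C) `^ (- ((alpha + eps) / a))
  else 0.

Lemma weight_bound_ge0 t : 0 <= weight_bound t.
Proof. by rewrite /weight_bound; case: ifP => // _; case: ifP => _; exact: powR_ge0. Qed.

Lemma vertex_weight_le q t : 0 < t -> 0 <= q ->
  q <= Num.max ((t / C) `^ (- a^-1)) ((t / C) `^ (- b^-1)) ->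
  vertex_weight alpha eps q <= weight_bound t.
Proof.
move=> t0 q0 hq; have [d0 de] := andP delta_range; have e0 := eps_gt0; have ea := eps_lt.
have a0 : 0 < a by rewrite /a; lra.
have b0 : 0 < b by rewrite /b; lra.
have ba : b <= a by rewrite /a /b; lra.
have tC : 0 < t / C by rewrite divr_gt0.
have pow_le (p r : R) : 0 <= r -> 0 < p -> q <= (t / C) `^ (- p^-1) ->
    q `^ r <= (t / C) `^ (- (r / p)).
  move=> r0 p0 hp; rewrite (_ : - (r / p) = - p^-1 * r); last by rewrite mulNr mulrC.
  rewrite powRrM.
  by apply: ge0_ler_powR => //; rewrite nnegrE// powR_ge0.
have iab : a^-1 <= b^-1 by rewrite lef_pV2.
rewrite /weight_bound t0; case: ifPn => [tle|]; rewrite ?ge_min ?le_min.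
  apply/orP; left; apply: pow_le => //; first by lra.
  apply: (le_trans hq); rewrite ge_max lexx andbT; apply: ger_powR; last by rewrite lerN2.
  by rewrite tC ler_pdivrMr// mul1r.
rewrite -ltNge => tC1; apply/orP; right; apply: pow_le => //; first by lra.
apply: (le_trans hq); rewrite ge_max lexx/=; apply: ler_powR; last by rewrite lerN2.
by rewrite ler_pdivlMr// mul1r ltW.
Qed.

Lemma measurable_weight_bound : measurable_fun setT weight_bound.
Proof.
have mpow p : measurable_fun setT (fun t : R => (t / C) `^ p).
  apply: (measurableT_comp (measurable_powR _)).
  exact: measurable_funM.
apply: measurable_fun_if => //; first exact: measurable_fun_ltr.
apply: measurable_funTS; apply: measurable_fun_if => //.
- exact: measurable_fun_ler.
- exact: measurable_funTS.
- exact: measurable_funTS.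
Qed.

End dominating_function.

(** * Image measures and the Pareto change of variables *)

Section image_measure.
Context d d' (T : measurableType d) (T' : measurableType d') (R : realType).
Variables (m : {measure set T -> \bar R}) (phi : T -> T').
Hypothesis mphi : measurable_fun [set: T] phi.

Definition pushforward_measure : {measure set T' -> \bar R}.
Proof. refine (pushforward m phi); exact: mphi. Defined.

Lemma ge0_integral_pushforward_measure (h : T' -> \bar R) :
  measurable_fun [set: T'] h -> (forall x, 0 <= h x)%E ->
  (\int[pushforward_measure]_x h x = \int[m]_t h (phi t))%E.
Proof. by move=> mh h0; rewrite /pushforward_measure ge0_integral_pushforward. Qed.

End image_measure.

Section real_image_measure.
Context d (T : measurableType d) (R : realType).
Variables (m : {measure set T -> \bar R}) (phi : T -> R).
Hypothesis mphi : measurable_fun [set: T] phi.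

Definition image_measure : {measure set (measurableTypeR R) -> \bar R} :=
  @pushforward_measure _ _ _ (measurableTypeR R) _ m phi mphi.

Lemma ge0_integral_image_measure (h : R -> \bar R) :
  measurable_fun [set: R] h -> (forall x, 0 <= h x)%E ->
  (\int[image_measure]_x h x = \int[m]_t h (phi t))%E.
Proof. by move=> mh h0; exact: ge0_integral_pushforward_measure. Qed.

End real_image_measure.

Section pareto_transfer.
Context {R : realType} (alpha : R).
Hypothesis alpha0 : 0 < alpha.
Local Notation mu := (@lebesgue_measure R).

Definition pareto_law : {measure set (measurableTypeR R) -> \bar R} :=
  density_measure mu (measurable_pareto_density alpha) (pareto_density_ge0 alpha0).

Definition pareto_image : {measure set (measurableTypeR R) -> \bar R} :=
  image_measure mu (measurable_pareto_quantile alpha).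

Lemma pareto_law_ray (x : R) : 0 < x ->
  pareto_law `]x, +oo[%classic = (x `^ (- alpha))%:E.
Proof. by move=> x0; rewrite -pareto_density_ray. Qed.

Lemma pareto_image_ray (x : R) : 0 < x ->
  pareto_image `]x, +oo[%classic = (x `^ (- alpha))%:E.
Proof. by move=> x0; rewrite -pareto_quantile_ray. Qed.

(** The substitution u = t^(- 1 / alpha), obtained by comparing measures rather than by a
    substitution theorem: the density and the image of Lebesgue measure give the same mass x^(-
    alpha) to each ray. *)
Lemma integral_pareto (h : R -> \bar R) :
  measurable_fun [set: R] h -> (forall x, 0 <= h x)%E ->
  (forall x, x <= 0 -> h x = 0%E) ->
  (\int[mu]_u (h u * (pareto_density alpha u)%:E) =
   \int[mu]_t h (pareto_quantile alpha t))%E.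
Proof.
move=> mh h0 hneg.
transitivity (\int[pareto_law]_u h u)%E; first by rewrite ge0_integral_density.
transitivity (\int[pareto_image]_t h t)%E; last by rewrite ge0_integral_image_measure.
apply: (@eq_integral_rays _ pareto_law pareto_image) => // x x0.
- by rewrite pareto_law_ray// pareto_image_ray.
- by rewrite pareto_law_ray// ltry.
Qed.

End pareto_transfer.

(** * Integrability of the majorant *)

Section weight_bound_integrable.
Context {R : realType}.
Variables (alpha eps delta C : R).
Hypothesis eps_gt0 : 0 < eps.
Hypothesis eps_lt : eps < alpha.
Hypothesis delta_range : 0 < delta < eps.
Hypothesis C_gt0 : 0 < C.
Local Notation mu := (@lebesgue_measure R).

Lemma integral_powR_tail (x p : R) : 0 < x -> 1 < p ->
  (\int[mu]_(t in `]x, +oo[) (t `^ (- p))%:E < +oo)%E.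
Proof.
move=> x0 p1; have q0 : 0 < p - 1 by rewrite subr_gt0.
under eq_integral => t.
  rewrite inE/= in_itv/= andbT => xt.
  rewrite (_ : t `^ (- p) = (p - 1)^-1 * pareto_density (p - 1) t); last first.
    rewrite /pareto_density (lt_trans x0 xt) mulrA mulVf ?gt_eqF// mul1r.
    by congr (_ `^ _); ring.
  rewrite EFinM.
  over.
rewrite ge0_integralZl//.
- by rewrite pareto_density_ray// ltry.
- by apply/measurable_EFinP; apply: measurable_funTS; exact: measurable_pareto_density.
- by move=> t _; rewrite lee_fin pareto_density_ge0.
- by rewrite lee_fin invr_ge0 ltW.
Qed.

Lemma integral_powR_head (x p : R) : 0 < x -> p < 1 ->
  (\int[mu]_(t in `]0%R, x[) (t `^ (- p))%:E < +oo)%E.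
Proof.
move=> x0 p1.
(* Substitute [t = u^-1]: [pareto_quantile 1] is the inversion on the half-line. *)
pose h (u : R) : \bar R := if x^-1 < u then (u `^ p)%:E else 0%E.
have mh : measurable_fun [set: R] h.
  apply: measurable_fun_if => //.
  - exact: measurable_fun_ltr.
  - by apply: measurable_funTS; apply/measurable_EFinP; exact: measurable_powR.
have h0 u : (0 <= h u)%E by rewrite /h; case: ifP => // _; rewrite lee_fin powR_ge0.
have hneg u : u <= 0 -> h u = 0%E.
  by move=> u0; rewrite /h ltNge (le_trans u0)// invr_ge0 ltW.
have ix0 : 0 < x^-1 by rewrite invr_gt0.
rewrite integral_mkcond.
rewrite [X in (X < _)%E](_ : _ = \int[mu]_t h (pareto_quantile 1 t))%E.
  rewrite -integral_pareto//.
  (* The inversion contributes the density u^(-2), so t^(- p) near 0 becomes u^(p - 2) at infinity,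
     and [2 - p > 1]. *)
  rewrite [X in (X < _)%E](_ : _ = \int[mu]_(u in `](x^-1)%R, +oo[) (u `^ (- (2 - p)))%:E)%E.
    by apply: integral_powR_tail => //; lra.
  rewrite [RHS]integral_mkcond; apply: eq_integral.
  move=> u _; rewrite /h patchE; case: ifPn => xu; last first.
    by rewrite mul0e ifF//; apply/negbTE; rewrite notin_setE/= in_itv/= andbT; exact/negP.
  rewrite mem_set/= ?in_itv/= ?andbT// -EFinM /pareto_density (lt_trans ix0 xu) mul1r.
  rewrite -powRD ?(gt_eqF (lt_trans ix0 xu)) ?implybT//.
  by congr (_ `^ _)%:E; ring.
apply: eq_integral => t _; rewrite patchE /h /pareto_quantile.
have [t0|t0] := ltP 0 t; last first.
  by rewrite memNset /= ?in_itv/= ltNge ?t0// invr_ge0 (ltW x0).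
rewrite invr1 powR_inv1 ?(ltW t0)// ltf_pV2 ?posrE//.
case: ltP => tx.
  rewrite mem_set/= ?in_itv/= ?t0//.
  by rewrite -powR_inv1 ?(ltW t0)// -powRrM mulN1r.
by rewrite memNset//= in_itv/= t0/= ltNge tx.
Qed.

Lemma weight_bound_integral_lty :
  (\int[mu]_t (weight_bound alpha eps delta C t)%:E < +oo)%E.
Proof.
have [d0 de] := andP delta_range; have e0 := eps_gt0; have ea := eps_lt.
have a0 : 0 < alpha + delta by lra.
have b0 : 0 < alpha - delta by lra.
have C2 : C < 2 * C by rewrite ltr_pMl// ltr1n.
pose p := (alpha - eps) / (alpha - delta); pose r := (alpha + eps) / (alpha + delta).
have p1 : p < 1 by rewrite ltr_pdivrMr// mul1r; lra.
have r1 : 1 < r by rewrite ltr_pdivlMr// mul1r; lra.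
have mpow q : measurable_fun [set: R] (fun t : R => t `^ (- q)) by exact: measurable_powR.
(* The interval reaches [2 * C] so that the open domain of the head integral contains the endpoint
   [t = C] of the first branch. *)
pose g1 : R -> \bar R := (fun t : R => (C `^ p)%:E * (t `^ (- p))%:E)%E \_ `]0, 2 * C[.
pose g2 : R -> \bar R := (fun t : R => (C `^ r)%:E * (t `^ (- r))%:E)%E \_ `]C, +oo[.
have mg1 : measurable_fun [set: R] g1.
  apply/(measurable_restrictT _ _).1 => //; apply: measurable_funTS.
  by apply: emeasurable_funM => //; exact/measurable_EFinP.
have mg2 : measurable_fun [set: R] g2.
  apply/(measurable_restrictT _ _).1 => //; apply: measurable_funTS.
  by apply: emeasurable_funM => //; exact/measurable_EFinP.
have g10 t : (0 <= g1 t)%E.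
  by apply: erestrict_ge0 => u _; rewrite -EFinM lee_fin mulr_ge0 ?powR_ge0.
have g20 t : (0 <= g2 t)%E.
  by apply: erestrict_ge0 => u _; rewrite -EFinM lee_fin mulr_ge0 ?powR_ge0.
apply: (@le_lt_trans _ _ (\int[mu]_t (g1 t + g2 t))%E).
  apply: ge0_le_integral => //.
  - by move=> t _; rewrite lee_fin weight_bound_ge0.
  - by apply/measurable_EFinP; exact: measurable_weight_bound.
  - exact: emeasurable_funD.
  - move=> t _; rewrite /weight_bound; case: ifPn => [t0|_]; last exact: adde_ge0.
    have powC q : ((t / C) `^ (- q))%:E = ((C `^ q)%:E * (t `^ (- q))%:E)%E.
      rewrite -EFinM powRM ?invr_ge0 ?(ltW t0) ?(ltW C_gt0)// mulrC.
      by rewrite -[C^-1]powR_inv1 ?(ltW C_gt0)// -powRrM mulN1r opprK.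
    case: ifPn => [tC|tC].
      rewrite powC -/p /g1 patchE mem_set ?leeDl//=.
      by rewrite in_itv/= t0 (le_lt_trans tC).
    rewrite powC -/r addeC /g2 patchE mem_set ?leeDl//=.
    by rewrite in_itv/= andbT ltNge.
rewrite ge0_integralD// lte_add_pinfty// -integral_mkcond ge0_integralZl//=.
all: rewrite ?lee_fin ?powR_ge0//.
- by rewrite lte_mul_pinfty ?lee_fin ?powR_ge0//; apply: integral_powR_head => //; rewrite mulr_gt0.
- by apply: measurable_funTS; exact/measurable_EFinP.
- by move=> t _; rewrite lee_fin powR_ge0.
- by rewrite lte_mul_pinfty ?lee_fin ?powR_ge0//; exact: integral_powR_tail.
- by apply: measurable_funTS; exact/measurable_EFinP.
- by move=> t _; rewrite lee_fin powR_ge0.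
Qed.

End weight_bound_integrable.

(** * The scaling limit *)

Section triangle_kernel.
Context {R : realType}.
Implicit Types (mu u v w : R).

Lemma measurable_edge_probability d (T : measurableType d) mu n (g h : T -> R) :
  measurable_fun [set: T] g -> measurable_fun [set: T] h ->
  measurable_fun [set: T] (fun t => edge_probability mu n (g t) (h t)).
Proof.
move=> mg mh; apply: measurable_minr => //.
by apply: measurable_funM => //; exact: measurable_funM.
Qed.

Lemma measurable_triangle_probability d (T : measurableType d) mu n (g h k : T -> R) :
  measurable_fun [set: T] g -> measurable_fun [set: T] h ->
  measurable_fun [set: T] k ->
  measurable_fun [set: T] (fun t => triangle_probability mu n (g t) (h t) (k t)).
Proof.
move=> mg mh mk; apply: measurable_funM; last exact: measurable_edge_probability.
by apply: measurable_funM; exact: measurable_edge_probability.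
Qed.

Lemma triangle_probability_ge0 mu n u v w :
  0 < mu -> 0 <= u -> 0 <= v -> 0 <= w -> 0 <= triangle_probability mu n u v w.
Proof. by move=> *; rewrite !mulr_ge0 ?edge_probability_ge0. Qed.

Lemma triangle_probability_eq0 mu n u v w : u = 0 \/ v = 0 \/ w = 0 ->
  triangle_probability mu n u v w = 0.
Proof.
have e0 x : edge_probability mu n 0 x = 0 by rewrite /edge_probability !mul0r min_l.
have e0' x : edge_probability mu n x 0 = 0 by rewrite /edge_probability mulr0 mul0r min_l.
rewrite /triangle_probability.
by move=> [->|[->|->]]; rewrite ?e0 ?e0' ?mul0r ?mulr0.
Qed.

Lemma cvg_edge_probability {T : Type} {F : set_system T} {FF : Filter F} mu n
    (g h : T -> R) a b :
  g x @[x --> F] --> a -> h x @[x --> F] --> b ->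
  edge_probability mu n (g x) (h x) @[x --> F] --> edge_probability mu n a b.
Proof.
(* Writing the minimum through an absolute value reduces its continuity to that of sums and
   norms. *)
move=> ga hb; rewrite /edge_probability; under eq_fun do rewrite minr_absE.
rewrite minr_absE.
have ghab : g x * h x / (mu * n%:R) @[x --> F] --> a * b / (mu * n%:R).
  by apply: cvgMl; exact: cvgM.
apply: cvgMl; apply: cvgB; first by apply: cvgD => //; exact: cvg_cst.
by apply: cvg_norm; apply: cvgB => //; exact: cvg_cst.
Qed.

Lemma cvg_triangle_probability {T : Type} {F : set_system T} {FF : Filter F} mu n
    (g h k : T -> R) a b c :
  g x @[x --> F] --> a -> h x @[x --> F] --> b -> k x @[x --> F] --> c ->
  triangle_probability mu n (g x) (h x) (k x) @[x --> F] -->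
  triangle_probability mu n a b c.
Proof.
move=> ga hb kc; apply: cvgM; last exact: cvg_edge_probability.
by apply: cvgM; exact: cvg_edge_probability.
Qed.

Lemma triangle_probability_scale mu n u v w :
  triangle_probability mu n u v w =
  triangle_probability mu 1 (u / Num.sqrt n%:R) (v / Num.sqrt n%:R) (w / Num.sqrt n%:R).
Proof.
have edge x y : edge_probability mu n x y =
    edge_probability mu 1 (x / Num.sqrt n%:R) (y / Num.sqrt n%:R).
  rewrite /edge_probability mulr1; congr Num.min.
  by rewrite mulrACA -invfM -expr2 sqr_sqrtr ?ler0n// invfM [RHS]mulrAC mulrA.
by rewrite /triangle_probability !edge.
Qed.

End triangle_kernel.

Section scaling_limit.
Context {R : realType}.
Variables (S : R -> R) (alpha mu : R).
Hypothesis S_noninc : {homo S : x y /~ x <= y}.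
Hypothesis S_gt0 : forall x, 0 < S x.
Hypothesis S_le1 : forall x, S x <= 1.
Hypothesis S_neg : forall x, x < 0 -> S x = 1.
Hypothesis S_right : forall x, S y @[y --> x^'+] --> S x.
Hypothesis S_cvg0 : S x @[x --> +oo] --> 0.
Hypothesis S_regular : forall x, 0 < x -> S (x * s) / S s @[s --> +oo] --> x `^ (- alpha).
Hypothesis alpha_range : 1 < alpha < 2.
Hypothesis mu_gt0 : 0 < mu.
Local Notation leb := (@lebesgue_measure R).
Local Notation cube := (square_measure leb \x leb)%E.
Local Notation K := (Num.max 1 mu^-1 ^+ 3).

(** The largest value with [alpha + 3 * eps <= 2]; the other margin [3 * eps <= alpha] then follows
    from [alpha > 1]. *)
Let eps := (2 - alpha) / 3.

(** The map [psi] is a parameter because the kernel is pulled back along scaled quantiles, along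
    their limit, and along the clipping map [Num.max 0]. *)
Definition triangle_profile (psi : R -> R) (p : R * R * R) : \bar R :=
  (triangle_probability mu 1 (psi p.1.1) (psi p.1.2) (psi p.2))%:E.

Lemma measurable_triangle_profile psi : measurable_fun [set: R] psi ->
  measurable_fun [set: R * R * R] (triangle_profile psi).
Proof.
move=> mpsi; apply/measurable_EFinP; apply: measurable_triangle_probability.
- by apply: (measurableT_comp mpsi); exact: (measurableT_comp measurable_fst).
- by apply: (measurableT_comp mpsi); exact: (measurableT_comp measurable_snd).
- by apply: (measurableT_comp mpsi); exact: measurable_snd.
Qed.

Lemma measurable_scaled_quantile s : 0 < s ->
  measurable_fun [set: R] (scaled_quantile S s).
Proof.
move=> s0; apply: (@measurable_inverse_tail _ _ (fun x => S (s * x) / S s)).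
- by move=> t; exact: scaled_quantile_ge0.
- by move=> x t x0; exact: lt_scaled_quantile.
Qed.

Section dominated.
Variables delta C : R.
Hypothesis delta_range : 0 < delta < eps.
Hypothesis C_gt0 : 0 < C.

Definition cube_bound (p : R * R * R) : \bar R :=
  (K * (weight_bound alpha eps delta C p.1.1 * weight_bound alpha eps delta C p.1.2
     * weight_bound alpha eps delta C p.2))%:E.

Lemma cube_constant_ge0 : 0 <= K.
Proof. by rewrite exprn_ge0// le_max ler01. Qed.

Lemma exponent_margins : [/\ 0 < eps, eps < alpha, 3 * eps <= alpha & alpha + 3 * eps <= 2].
Proof. by have [a1 a2] := andP alpha_range; rewrite /eps; split; lra. Qed.

Lemma cube_bound_ge0 p : (0 <= cube_bound p)%E.
Proof. by rewrite lee_fin mulr_ge0 ?cube_constant_ge0// !mulr_ge0 ?weight_bound_ge0. Qed.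

Lemma measurable_cube_bound : measurable_fun [set: R * R * R] cube_bound.
Proof.
have mwb := measurable_weight_bound alpha eps delta C.
apply/measurable_EFinP; apply: measurable_funM => //.
apply: measurable_funM; last by apply: (measurableT_comp mwb); exact: measurable_snd.
apply: measurable_funM; apply: (measurableT_comp mwb).
- exact: (measurableT_comp measurable_fst).
- exact: (measurableT_comp measurable_snd).
Qed.

Lemma integrable_cube_bound : cube.-integrable setT cube_bound.
Proof.
have [e0 ea _ _] := exponent_margins.
apply/integrableP; split; first exact: measurable_cube_bound.
under eq_integral do rewrite gee0_abs ?cube_bound_ge0//.
have Ifin : (\int[leb]_t (weight_bound alpha eps delta C t)%:E)%E \is a fin_num.
  rewrite ge0_fin_numE; first exact: weight_bound_integral_lty.
  by apply: integral_ge0 => t _; rewrite lee_fin weight_bound_ge0.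
rewrite triple_integral_separated ?cube_constant_ge0//.
- by rewrite -(fineK Ifin) -!EFinM ltry.
- exact: measurable_weight_bound.
- exact: weight_bound_ge0.
Qed.

Lemma triangle_profile_le s : 0 < s ->
  (forall x, 0 < x -> S (s * x) <= C * S s *
     Num.max (x `^ (- (alpha + delta))) (x `^ (- (alpha - delta)))) ->
  forall p, (`|triangle_profile (scaled_quantile S s) p| <= cube_bound p)%E.
Proof.
move=> s0 HS p; have [e0 ea ale agt] := exponent_margins.
have q0 t : 0 <= scaled_quantile S s t by exact: scaled_quantile_ge0.
have wq t : vertex_weight alpha eps (scaled_quantile S s t)
    <= weight_bound alpha eps delta C t.
  have [t0|t0] := ltP 0 t.
    apply: vertex_weight_le => //.
    apply: (scaled_quantile_le e0 ea delta_range C_gt0 S_gt0 HS) => // x x0.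
    exact: lt_scaled_quantile.
  (* For [t <= 0] the quantile is 0, and so is its weight because both exponents are nonzero. *)
  rewrite /scaled_quantile /weight_bound ltNge t0/= /vertex_weight.
  by rewrite !powR0 ?minxx// gt_eqF//; lra.
rewrite gee0_abs ?lee_fin ?triangle_probability_ge0//.
apply: (le_trans (triangle_probability_le_prod mu_gt0 ale agt e0 _ _ _)) => //.
have vw0 x : 0 <= vertex_weight alpha eps x by rewrite le_min !powR_ge0.
by rewrite ler_wpM2l ?cube_constant_ge0// !ler_pM ?mulr_ge0.
Qed.

End dominated.

Lemma cvg_triangle_profile p :
  triangle_profile (scaled_quantile S s) p @[s --> +oo] -->
  triangle_profile (pareto_quantile alpha) p.
Proof.
have [a1 _] := andP alpha_range.
have cq t : scaled_quantile S s t @[s --> +oo] --> pareto_quantile alpha t.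
  apply: cvg_scaled_quantile => //; first by apply: lt_trans a1.
  move=> x x0; have -> : (fun s => S (s * x) / S s) = (fun s => S (x * s) / S s).
    by apply/funext => s; rewrite [s * x]mulrC.
  exact: S_regular.
by apply: cvg_EFin; [exact: nearW|exact: cvg_triangle_probability].
Qed.

Definition limit_integral : \bar R :=
  (\int[cube]_p triangle_profile (pareto_quantile alpha) p)%E.

Lemma scaling_limit (sq : nat -> R) : sq n @[n --> \oo] --> +oo ->
  limit_integral \is a fin_num /\
  (\int[cube]_p triangle_profile (scaled_quantile S (sq n)) p)%E @[n --> \oo]
    --> limit_integral.
Proof.
move=> sqy; have [e0 ea _ _] := exponent_margins.
pose delta := eps / 2.
have delta_range : 0 < delta < eps by rewrite /delta; apply/andP; split; lra.
have da : 0 < delta < alpha.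
  by case/andP: delta_range => ? ?; apply/andP; split => //; apply: lt_trans ea.
have [C [x0 [C0 x00 HC]]] := potter_bound S_noninc S_gt0 S_le1 (S_regular (ltr0n _ 2)) da.
(* The Potter bound holds only at scales beyond [x0], whereas dominated convergence asks for the
   majorant at every index; hence the shift by [N]. *)
have [N _ HN] : \forall n \near \oo, x0 <= sq n by move/cvgryPge : sqy; exact.
have sN n : x0 <= sq (n + N)%N by apply: HN; rewrite /= leq_addl.
have sN0 n : 0 < sq (n + N)%N by apply: lt_le_trans (sN n).
have [] := @dominated_convergence _ _ _ cube setT measurableT
  (fun n => triangle_profile (scaled_quantile S (sq (n + N)%N)))
  (triangle_profile (pareto_quantile alpha)) (cube_bound delta C).
- by move=> n; apply: measurable_triangle_profile; exact: measurable_scaled_quantile.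
- by apply: measurable_triangle_profile; exact: measurable_pareto_quantile.
- apply: aeW => p _.
  have sy : sq (n + N)%N @[n --> \oo] --> +oo by rewrite (cvg_shiftn N sq).
  exact: (cvg_comp _ _ sy (@cvg_triangle_profile p)).
- exact: integrable_cube_bound.
- apply: aeW => p n _; apply: triangle_profile_le => // x x_gt0.
  exact: HC.
move=> int _ c; split; first exact: integrable_fin_num.
by rewrite -(cvg_shiftn N).
Qed.

(** On the unit cube the limit quantiles are at least 1, so each of the three edge factors is at
    least min(1 / mu, 1). *)
Lemma limit_integral_gt0 : (0 < limit_integral)%E.
Proof.
have [a1 _] := andP alpha_range.
have a0 : 0 < alpha by exact: lt_trans a1.
pose k := Num.min mu^-1 1.
have k0 : 0 < k by rewrite lt_min invr_gt0 mu_gt0 ltr01.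
pose I : set R := `]0, 1[%classic.
have mI : measurable I by exact: measurable_itv.
have p0 t : 0 <= pareto_quantile alpha t by exact: pareto_quantile_ge0.
have pI t : I t -> 1 <= pareto_quantile alpha t.
  by rewrite /I/= in_itv/= => tI; apply: ltW; rewrite lt_pareto_quantile// powR1.
have edgeI x y : I x -> I y ->
    k <= edge_probability mu 1 (pareto_quantile alpha x) (pareto_quantile alpha y).
  move=> Ix Iy; rewrite /edge_probability mulr1 le_min; apply/andP; split; last first.
    by rewrite /k ge_min lexx orbT.
  rewrite (@le_trans _ _ mu^-1) ?/k ?ge_min ?lexx//.
  rewrite ler_peMl ?invr_ge0 ?(ltW mu_gt0)//.
  by rewrite (le_trans (pI _ Ix))// ler_peMr// pI.
have I1 : (\int[leb]_t (\1_I t)%:E = 1)%E.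
  have lebI : leb I = 1%E by rewrite lebesgue_measure_itv/= lte_fin ltr01 oppr0 adde0.
  by rewrite integral_indic// setIT; exact: lebI.
apply: (@lt_le_trans _ _ (\int[cube]_p (k ^+ 3 * (\1_I p.1.1 * \1_I p.1.2 * \1_I p.2))%:E)%E).
  rewrite triple_integral_separated ?exprn_ge0 ?(ltW k0)// I1// !mule1 lte_fin.
  exact: exprn_gt0.
have mindic : measurable_fun [set: R] (\1_I : R -> R) by exact: measurable_indic.
apply: ge0_le_integral => //.
- by move=> p _; rewrite lee_fin mulr_ge0 ?exprn_ge0 ?(ltW k0)// !mulr_ge0.
- apply/measurable_EFinP; apply: measurable_funM => //.
  apply: measurable_funM; last by apply: (measurableT_comp mindic); exact: measurable_snd.
  apply: measurable_funM; apply: (measurableT_comp mindic).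
  + exact: (measurableT_comp measurable_fst).
  + exact: (measurableT_comp measurable_snd).
- by apply: measurable_triangle_profile; exact: measurable_pareto_quantile.
move=> p _; rewrite lee_fin !indicE.
have F0 := triangle_probability_ge0 1 mu_gt0 (p0 p.1.1) (p0 p.1.2) (p0 p.2).
have [/set_mem Ix|_] := boolP (p.1.1 \in I); last by rewrite !mul0r mulr0.
have [/set_mem Iy|_] := boolP (p.1.2 \in I); last by rewrite mulr0 mul0r mulr0.
have [/set_mem Iz|_] := boolP (p.2 \in I); last by rewrite !mulr0.
rewrite !mulr1 (_ : k ^+ 3 = k * k * k); last by ring.
by rewrite !ler_pM ?mulr_ge0 ?edgeI// ltW.
Qed.

End scaling_limit.

(** * Reduction of laws and densities to the cube *)

Section triple_rays.
Local Open Scope ereal_scope.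
Context {R : realType}.
Local Notation leb := (@lebesgue_measure R).
Local Notation cube := (square_measure leb \x leb).

(** The measures are exchanged one variable at a time, innermost first; each partial integral still
    vanishes on the non-positive half-line. *)
Lemma eq_triple_integral_rays
    (m1 m2 : {measure set (measurableTypeR R) -> \bar R}) (f : R * R * R -> \bar R) :
  (forall x, (0 < x)%R -> m1 `]x, +oo[%classic = m2 `]x, +oo[%classic) ->
  (forall x, (0 < x)%R -> m1 `]x, +oo[%classic < +oo) ->
  (forall x y z, [|| x <= 0, y <= 0 | z <= 0]%R -> f (x, y, z) = 0) ->
  \int[m1]_x \int[m1]_y \int[m1]_z f (x, y, z) =
  \int[m2]_x \int[m2]_y \int[m2]_z f (x, y, z).
Proof.
move=> m12 m1fin f0.
have inner x y : \int[m1]_z f (x, y, z) = \int[m2]_z f (x, y, z).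
  by apply: eq_integral_rays => // z z0; rewrite f0// z0 !orbT.
have middle x : \int[m1]_y \int[m1]_z f (x, y, z) = \int[m2]_y \int[m2]_z f (x, y, z).
  under eq_integral => y _ do rewrite inner.
  apply: eq_integral_rays => // y y0.
  by apply: integral0_eq => z _; rewrite f0// y0 orbT.
under eq_integral => x _ do rewrite middle.
apply: eq_integral_rays => // x x0.
by apply: integral0_eq => y _; apply: integral0_eq => z _; rewrite f0// x0.
Qed.

Lemma triple_integral_scaled_image (c : {nonneg R}) (psi : R -> R)
    (mpsi : measurable_fun [set: R] psi) (f : R * R * R -> \bar R) :
  measurable_fun [set: R * R * R] f -> (forall p, 0 <= f p) ->
  let m := mscale c (image_measure leb mpsi) in
  \int[m]_x \int[m]_y \int[m]_z f (x, y, z) =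
  (c%:num ^+ 3)%:E * \int[cube]_p f (psi p.1.1, psi p.1.2, psi p.2).
Proof.
move=> mf f0 m.
have mfpsi : measurable_fun [set: R * R * R]
    (fun p : R * R * R => f (psi p.1.1, psi p.1.2, psi p.2)).
  apply: (measurableT_comp mf); apply: measurable_fun_pair.
    apply: measurable_fun_pair.
    - by apply: (measurableT_comp mpsi); exact: (measurableT_comp measurable_fst).
    - by apply: (measurableT_comp mpsi); exact: (measurableT_comp measurable_snd).
  by apply: (measurableT_comp mpsi); exact: measurable_snd.
rewrite (@triple_integral_transfer R m psi (cst c%:num))//; last first.
  move=> h mh h0; rewrite /m ge0_integral_mscale// ge0_integral_image_measure//.
  rewrite /cst ge0_integralZr ?lee_fin//; first by rewrite muleC.
  exact: (measurableT_comp mh mpsi).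
rewrite -(@triple_integral_prod _ (measurableTypeR R) R leb (fun p =>
  f (psi p.1.1, psi p.1.2, psi p.2) * (c%:num * c%:num * c%:num)%:E)); last 2 first.
- exact: emeasurable_funM.
- by move=> p; rewrite mule_ge0// lee_fin !mulr_ge0.
rewrite ge0_integralZr// ?lee_fin ?mulr_ge0// muleC; congr (_%:E * _).
by rewrite !exprS expr0 mulr1 mulrA.
Qed.

End triple_rays.

Section clipped_kernel.
Context {R : realType}.
Variable mu : R.
Hypothesis mu_gt0 : 0 < mu.
Local Notation leb := (@lebesgue_measure R).
Local Notation cube := (square_measure leb \x leb)%E.

(* [triangle_probability] need not vanish at negative weights; clipping makes it
   vanish off the open positive octant, so that its integrals depend only on the
   tails of the measures on the half-line. *)
Definition clipped_triangle : R * R * R -> \bar R := triangle_profile mu (Num.max 0).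

Lemma measurable_clipped_triangle : measurable_fun [set: R * R * R] clipped_triangle.
Proof. by apply: measurable_triangle_profile; exact: measurable_maxr. Qed.

Lemma clipped_triangle_ge0 p : (0 <= clipped_triangle p)%E.
Proof. by rewrite lee_fin triangle_probability_ge0// le_max lexx. Qed.

Lemma clipped_triangle_eq0 x y z : [|| x <= 0, y <= 0 | z <= 0] ->
  clipped_triangle (x, y, z) = 0%E.
Proof.
rewrite /clipped_triangle /triangle_profile/= => xyz; congr EFin.
by apply: triangle_probability_eq0; case/or3P: xyz => /max_l ->; tauto.
Qed.

Lemma clipped_triangleE x y z : 0 <= x -> 0 <= y -> 0 <= z ->
  clipped_triangle (x, y, z) = (triangle_probability mu 1 x y z)%:E.
Proof. by move=> x0 y0 z0; rewrite /clipped_triangle /triangle_profile/= !max_r. Qed.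

(** The Pareto density carries a factor [alpha] that the integrand of the constant lacks. Scaling
    the measure by 1 / alpha in each variable yields alpha^(-3), which cancels alpha^3 and leaves 1
    / 6. *)
Lemma triangle_constantE alpha : 0 < alpha ->
  triangle_constant mu alpha = (6^-1%:E * limit_integral alpha mu)%E.
Proof.
move=> alpha0.
have ia0 : 0 <= alpha^-1 by rewrite invr_ge0 ltW.
pose c : {nonneg R} := NngNum ia0.
have dens u : 0 < u -> pareto_density alpha u / alpha = u `^ (- alpha - 1).
  by move=> u0; rewrite /pareto_density u0 mulrAC mulfV ?gt_eqF// mul1r.
have dens0 u : u <= 0 -> pareto_density alpha u = 0.
  by move=> u0; rewrite /pareto_density ltNge u0.
have integral_pos (h h' : R -> \bar R) : (forall u, 0 < u -> h u = h' u) ->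
    (forall u, u <= 0 -> h' u = 0%E) ->
    (\int[leb]_(u in `]0%R, +oo[) h u = \int[leb]_u h' u)%E.
  move=> hh' h'0; rewrite ge0_integral_gt0E//; apply: eq_integral => u.
  by rewrite inE/= in_itv/= andbT; exact: hh'.
transitivity ((alpha ^+ 3 / 6)%:E * \int[mscale c (pareto_law alpha0)]_x
    \int[mscale c (pareto_law alpha0)]_y \int[mscale c (pareto_law alpha0)]_z
      clipped_triangle (x, y, z))%E.
  congr (_ * _)%E.
  rewrite (@triple_integral_transfer R _ id (fun u => pareto_density alpha u / alpha)).
  - apply: (integral_pos _ _) => u u0.
      apply: (integral_pos _ _) => v v0.
        apply: (integral_pos _ _) => w w0.
          rewrite clipped_triangleE ?ltW// !dens// -EFinM !mulrA; congr EFin; ring.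
        by rewrite (dens0 w)// mul0r mulr0 mule0.
      by apply: integral0_eq => w _; rewrite (dens0 v)// mul0r mulr0 mul0r mule0.
    apply: integral0_eq => v _; apply: integral0_eq => w _.
    by rewrite (dens0 u)// !mul0r mule0.
  - exact: measurable_id.
  - by apply: measurable_funM => //; exact: measurable_pareto_density.
  - by move=> t; rewrite divr_ge0 ?pareto_density_ge0// ltW.
  - move=> h mh h0; rewrite ge0_integral_mscale//.
    rewrite ge0_integral_density// -ge0_integralZl//.
    + by apply: eq_integral => u _; rewrite [LHS]muleCA -EFinM mulrC.
    + apply: emeasurable_funM => //; apply/measurable_EFinP.
      exact: measurable_pareto_density.
    + by move=> u _; rewrite mule_ge0// lee_fin pareto_density_ge0.
  - exact: measurable_clipped_triangle.
  - exact: clipped_triangle_ge0.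
rewrite (@eq_triple_integral_rays _ _ (mscale c (pareto_image alpha))); last 3 first.
- by move=> x x0; rewrite /= /mscale pareto_law_ray// pareto_image_ray.
- by move=> x x0; rewrite /= /mscale pareto_law_ray// -EFinM ltry.
- exact: clipped_triangle_eq0.
rewrite (triple_integral_scaled_image c (measurable_pareto_quantile alpha)); last 2 first.
- exact: measurable_clipped_triangle.
- exact: clipped_triangle_ge0.
rewrite muleA -EFinM; congr (_%:E * _)%E.
  rewrite /= exprVn mulrAC mulfV ?mul1r// expf_neq0// gt_eqF//.
apply: eq_integral => p _.
by rewrite clipped_triangleE ?pareto_quantile_ge0.
Qed.

(** An atom of [nu] at 0 is invisible to the clipped kernel, so agreement of [nu] on rays with [S s]
    times the image under the quantile suffices; the factor comes out cubed. *)
Lemma triple_integral_law (S : R -> R) s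
    (nu : {measure set (measurableTypeR R) -> \bar R})
    (mq : measurable_fun [set: R] (scaled_quantile S s)) :
  (forall x, 0 < S x) ->
  (forall t, 0 <= scaled_quantile S s t) ->
  (forall x t, 0 <= x -> (x < scaled_quantile S s t) = (0 < t < S (s * x) / S s)) ->
  (forall x, 0 < x -> nu `]x, +oo[%classic = (S (s * x))%:E) ->
  (\int[nu]_x \int[nu]_y \int[nu]_z clipped_triangle (x, y, z) =
   (S s ^+ 3)%:E * \int[cube]_p triangle_profile mu (scaled_quantile S s) p)%E.
Proof.
move=> S0 q0 lt_q nuE.
pose c : {nonneg R} := NngNum (ltW (S0 s)).
rewrite (@eq_triple_integral_rays _ _ (mscale c (image_measure leb mq))); last 3 first.
- move=> x x0; rewrite nuE//.
  transitivity ((S s)%:E * (S (s * x) / S s)%:E)%E.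
    by rewrite -EFinM [X in _ = X%:E]mulrCA mulfV ?mulr1// gt_eqF.
  rewrite -[RHS]/((S s)%:E * leb (scaled_quantile S s @^-1` `]x, +oo[%classic))%E.
  congr (_ * _)%E; apply/esym; apply: (lebesgue_inverse_tail (tail := fun x => S (s * x) / S s) lt_q (ltW x0)).
  by rewrite divr_ge0 ?ltW.
- by move=> x x0; rewrite nuE// ltry.
- exact: clipped_triangle_eq0.
rewrite (triple_integral_scaled_image c mq); last 2 first.
- exact: measurable_clipped_triangle.
- exact: clipped_triangle_ge0.
congr (_ * _)%E; apply: eq_integral => p _.
by rewrite clipped_triangleE.
Qed.

End clipped_kernel.

(** * Expected number of triangles *)

Section joint_law.
Local Open Scope ereal_scope.

Lemma eq_finite_measure_rectangles d1 d2 (T1 : measurableType d1)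
    (T2 : measurableType d2) (R : realType)
    (m1 m2 : {measure set (T1 * T2)%type -> \bar R}) :
  m1 setT < +oo ->
  (forall A B, measurable A -> measurable B -> m1 (A `*` B) = m2 (A `*` B)) ->
  forall X, measurable X -> m1 X = m2 X.
Proof.
move=> m1T m12 X mX.
apply: (measure_unique [set A `*` B | A in measurable & B in measurable]
  (fun=> setT)) => //.
- exact: measurable_prod_measurableType.
- move=> _ _ [A mA [B mB <-]] [A' mA' [B' mB' <-]].
  exists (A `&` A'); first exact: measurableI.
  by exists (B `&` B'); [exact: measurableI|rewrite setXI].
- by move=> _; exists setT => //; exists setT => //; exact: setXTT.
- by apply/seteqP; split => // x _; exists 0%N.
- by move=> _ [A mA [B mB <-]]; exact: m12.
Qed.

Context d d' (T : measurableType d) (T' : measurableType d') (R : realType).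
Variables (P : probability T R) (nu : probability T' R) (X Y Z : T -> T').
Hypotheses (mX : measurable_fun [set: T] X) (mY : measurable_fun [set: T] Y)
  (mZ : measurable_fun [set: T] Z).
Hypothesis XYZ : forall A B C, measurable A -> measurable B -> measurable C ->
  P (X @^-1` A `&` Y @^-1` B `&` Z @^-1` C) = nu A * nu B * nu C.

(** Independence identifies the joint law with the product on boxes. Rectangles in a product of two
    factors are handled twice, first for the pair with the third set fixed, then for the triple. *)
Lemma integral_joint_law (h : T' * T' * T' -> \bar R) :
  measurable_fun [set: T' * T' * T'] h -> (forall p, 0 <= h p) ->
  \int[P]_t h (X t, Y t, Z t) = \int[nu]_x \int[nu]_y \int[nu]_z h (x, y, z).
Proof.
move=> mh h0.
have mpre (f : T -> T') A : measurable_fun [set: T] f -> measurable A ->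
    measurable (f @^-1` A).
  by move=> mf mA; rewrite -[X in measurable X]setTI; exact: mf.
have mXY : measurable_fun [set: T] (fun t => (X t, Y t)) by exact: measurable_fun_pair.
have mXYZ : measurable_fun [set: T] (fun t => (X t, Y t, Z t)).
  exact: measurable_fun_pair.
pose m3 := pushforward_measure P mXYZ.
have law2 A C : measurable A -> measurable C ->
    P ((fun t => (X t, Y t)) @^-1` A `&` Z @^-1` C) = square_measure nu A * nu C.
  move=> mA mC; have mZC := mpre _ _ mZ mC.
  have nuC_ge0 : (0 <= fine (nu C))%R by rewrite fine_ge0.
  have nuCE : (fine (nu C))%:E = nu C by rewrite fineK// fin_num_measure.
  (* With [C] fixed, both sides are finite measures in [A]: the law of the pair under [P] restricted
     to the event on [Z], and the product law scaled by [nu C]. *)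
  transitivity (pushforward_measure (mrestr P mZC) mXY A) => //.
  transitivity (mscale (NngNum nuC_ge0) (square_measure nu) A); last first.
    by rewrite /mscale/= nuCE muleC.
  apply: eq_finite_measure_rectangles => //.
    rewrite /pushforward_measure/= /pushforward /mrestr preimage_setT setTI.
    by rewrite (le_lt_trans (probability_le1 P mZC))// ltry.
  move=> A1 A2 mA1 mA2; 
  rewrite -[RHS]/((fine (nu C))%:E * (nu \x nu) (A1 `*` A2)) nuCE.
  rewrite product_measure1E//= muleC.
  by rewrite -XYZ//.
transitivity (\int[m3]_p h p); first by rewrite ge0_integral_pushforward_measure.
rewrite -triple_integral_prod//; apply: eq_measure_integral => B mB _.
apply: eq_finite_measure_rectangles => //.
  rewrite /m3/= /pushforward preimage_setT.
  by rewrite (le_lt_trans (probability_le1 P measurableT))// ltry.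
move=> A C mA mC; rewrite -[RHS]/((square_measure nu \x nu) (A `*` C)).
by rewrite product_measure1E//= -law2.
Qed.

End joint_law.

(** The increasing listing is needed because the edge events are specified only for ordered pairs
    with smaller first entry. *)
Lemma card3_sorted n (t : {set 'I_n}) : #|t| = 3 ->
  exists i j k : 'I_n, [/\ (i < j)%N, (j < k)%N & t = [set i; j; k]%SET].
Proof.
move=> t3; have /card_gt0P[x0 x0t] : (0 < #|t|)%N by rewrite t3.
have [i it0 imin] := arg_minnP (fun i : 'I_n => i : nat) x0t.
have it : i \in t by exact: it0.
have /eqP/cards2P[y [z [yz tE]]] : #|t :\ i| = 2.
  by have := cardsD1 i t; rewrite it t3 => -[].
have lti x : x \in t :\ i -> (i < x)%N.
  by rewrite !inE => /andP[xi /imin ix]; rewrite ltn_neqAle ix andbT eq_sym.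
have iy : (i < y)%N by apply: lti; rewrite tE !inE eqxx.
have iz : (i < z)%N by apply: lti; rewrite tE !inE eqxx orbT.
have tE' : t = (i |: [set y; z])%SET by rewrite -tE finset.setD1K.
have [lt_yz|lt_zy|/val_inj eq_yz] := ltngtP y z.
- by exists i, y, z; split => //; rewrite tE' finset.setUA.
- by exists i, z, y; split => //; rewrite tE'; apply/setP => x; rewrite !inE -!orbA; congr orb; exact: orbC.
- by rewrite eq_yz eqxx in yz.
Qed.

Section graph_expectation.
Context d (T : measurableType d) (R : realType) (P : probability T R).

Definition clique (n : nat) (e : rel 'I_n) (t : {set 'I_n}) : bool :=
  [forall i in t, forall j in t, (i != j) ==> e i j].

Lemma clique3 n (e : rel 'I_n) (i j k : 'I_n) :
  symmetric e -> (i < j)%N -> (j < k)%N ->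
  clique e [set i; j; k]%SET = [&& e i j, e j k & e i k].
Proof.
move=> esym ij jk; have ik := ltn_trans ij jk.
apply/idP/idP => [|/and3P[eij ejk eik]].
  move=> /forall_inP H; have H' x y : x \in [set i; j; k]%SET -> y \in [set i; j; k]%SET ->
      x != y -> e x y by move=> xt yt; move/(_ _ xt)/forall_inP/(_ _ yt)/implyP : H.
  apply/and3P; split; apply: H'; rewrite ?inE ?eqxx ?orbT//.
  - by rewrite -val_eqE ltn_eqF.
  - by rewrite -val_eqE ltn_eqF.
  - by rewrite -val_eqE ltn_eqF.
apply/forall_inP => x; rewrite !inE => xt; apply/forall_inP => y; rewrite !inE => yt.
apply/implyP => xy.
case/orP: xt xy => [/orP[]|] /eqP->; case/orP: yt => [/orP[]|] /eqP->;
  by rewrite ?eqxx// esym.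
Qed.

Lemma card_triangles n (e : rel 'I_n) :
  #|triangles e| = (\sum_(t : {set 'I_n} | #|t| == 3) clique e t)%N.
Proof.
rewrite /triangles -sum1dep_card big_mkcondr/=.
by apply: eq_bigr => t _; rewrite -/(clique e t); case: (clique e t).
Qed.

Lemma sum_over_triangles n (V : R) (g : T -> rel 'I_n) :
  (forall t : {set 'I_n}, #|t| = 3 -> measurable [set w | clique (g w) t]) ->
  (forall t : {set 'I_n}, #|t| = 3 -> P [set w | clique (g w) t] = V%:E) ->
  expected_triangles P g = ('C(n, 3)%:R * V)%:E.
Proof.
move=> mE PE; rewrite /expected_triangles unlock.
(* Extending by 0 to sets of other sizes confines the measurability requirement to 3-sets. *)
pose f (t : {set 'I_n}) w : \bar R :=
  if #|t| == 3 then (\1_[set w | clique (g w) t] w)%:E else 0%E.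
transitivity (\int[P]_w \sum_(t : {set 'I_n}) f t w)%E.
  apply: eq_integral => w _; rewrite card_triangles natr_sum -sumEFin big_mkcond/=.
  by apply: eq_bigr => t _; rewrite /f; case: ifP => // _; rewrite indicE mem_setE.
rewrite ge0_integral_sum//; last 2 first.
- move=> t; rewrite /f; case: eqP => // t3.
  by apply/measurable_EFinP/measurable_indic; exact: mE.
- by move=> t w _; rewrite /f; case: ifP => // _; rewrite lee_fin.
transitivity (\sum_(t : {set 'I_n} | #|t| == 3%N) V%:E)%E.
  rewrite [RHS]big_mkcond/=; apply: eq_bigr => t _; rewrite /f; case: eqP => t3.
    by rewrite integral_indic ?setIT//; [exact: PE|exact: mE].
  by rewrite integral0.
rewrite sumEFin; congr EFin; rewrite sumr_const mulr_natl; congr (_ *+ _).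
rewrite -[in RHS](card_ord n) -card_draws cardsE.
by apply: eq_card => t.
Qed.

End graph_expectation.

Section triangle_event.
Context d (T : measurableType d) (R : realType) (P : probability T R).
Variable W : nat -> {RV P >-> R}.
Local Notation mu := (mean (W 0%N)).

Lemma sigma_firstT n : sigma_first W n setT.
Proof.
have [s0 sC sU] := smallest_sigma_algebra [set: T]
  (\bigcup_(i in `I_n) preimage_set_system [set: T] (W i) measurable).
by rewrite -(setD0 [set: T]); apply: sC.
Qed.

(** Conditional independence is applied to the three edges of the triangle, and the conditional
    probability is tested on the whole space, that is, its expectation is taken. *)
Lemma clique_probability n (g : T -> rel 'I_n) (i j k : 'I_n) :
  weighted_random_graph W g -> (i < j)%N -> (j < k)%N ->
  measurable [set w | clique (g w) [set i; j; k]%SET] /\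
  P [set w | clique (g w) [set i; j; k]%SET] =
    (\int[P]_w (triangle_probability mu n (W i w) (W j w) (W k w))%:E)%E.
Proof.
move=> [gsym _ gcond] ij jk; have ik := ltn_trans ij jk.
have ijN : i != j by rewrite -val_eqE ltn_eqF.
have jkN : j != k by rewrite -val_eqE ltn_eqF.
pose S : {set 'I_n * 'I_n} := [set (i, j); (j, k); (i, k)]%SET.
have SD : S \subset [set e : 'I_n * 'I_n | (e.1 < e.2)%N]%SET.
  by apply/fintype.subsetP => e; rewrite !inE => /orP[/orP[]|] /eqP->.
have [mA _ _ intA] := gcond S SD.
have cliqueE : \bigcap_(e in [set` S]) [set w | g w e.1 e.2]
    = [set w | clique (g w) [set i; j; k]%SET].
  apply/seteqP; split => w /=.
    move=> H; rewrite clique3//; apply/and3P; split.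
    - by apply: (H (i, j)); rewrite /= !inE eqxx.
    - by apply: (H (j, k)); rewrite /= !inE eqxx orbT.
    - by apply: (H (i, k)); rewrite /= !inE eqxx orbT.
  rewrite clique3// => /and3P[gij gjk gik] e /=.
  by rewrite !inE => /orP[/orP[]|] /eqP->.
rewrite -cliqueE; split => //.
have := intA _ (@sigma_firstT n); rewrite setIT => <-.
apply: eq_integral => w _; congr EFin.
rewrite /S finset.setUC big_setU1/=; last first.
  by rewrite !inE !xpair_eqE (negbTE ijN) eq_sym (negbTE jkN) andbF.
rewrite finset.setUC big_setU1/=; last first.
  by rewrite !inE !xpair_eqE eq_sym (negbTE ijN).
by rewrite big_set1 /triangle_probability mulrC [X in X * _ = _]mulrC.
Qed.

Lemma independent_triple i j k (A B C : set R) :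
  iid W -> i != j -> j != k -> i != k ->
  measurable A -> measurable B -> measurable C ->
  P (W i @^-1` A `&` W j @^-1` B `&` W k @^-1` C) =
  (P (W 0%N @^-1` A) * P (W 0%N @^-1` B) * P (W 0%N @^-1` C))%E.
Proof.
move=> [indep ident] ij jk ik mA mB mC.
pose D l := if l == i then A else if l == j then B else C.
have Di : D i = A by rewrite /D eqxx.
have Dj : D j = B by rewrite /D eq_sym (negbTE ij) eqxx.
have Dk : D k = C by rewrite /D [k == i]eq_sym (negbTE ik) eq_sym (negbTE jk).
have := indep [:: i; j; k] D; rewrite /= !inE negb_or ij ik jk => /(_ isT) H.
have {}H := H _; rewrite !big_cons big_nil mule1 Di Dj Dk in H.
rewrite -(ident i 0%N)// -(ident j 0%N)// -(ident k 0%N)// -muleA -H; last first.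
  by move=> l; rewrite /D; case: ifP => // _; case: ifP.
congr (P _); apply/seteqP; split => w /=.
  move=> [[WA WB] WC] l /=; rewrite !inE => /or3P[] /eqP->.
  - by rewrite Di.
  - by rewrite Dj.
  - by rewrite Dk.
move=> H'; split; [split|].
- by have := H' i; rewrite /= Di; apply; rewrite inE eqxx.
- by have := H' j; rewrite /= Dj; apply; rewrite !inE eqxx orbT.
- by have := H' k; rewrite /= Dk; apply; rewrite !inE eqxx !orbT.
Qed.

End triangle_event.

Section expected_triangles.
Context d (T : measurableType d) (R : realType) (P : probability T R).
Variable W : nat -> {RV P >-> R}.
Hypothesis W_iid : iid W.
Hypothesis W_ge0 : forall i w, 0 <= W i w.
Local Notation mu := (mean (W 0%N)).
Local Notation S := (tail_function (W 0%N)).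
Local Notation leb := (@lebesgue_measure R).
Local Notation cube := (square_measure leb \x leb)%E.
Hypothesis mu_gt0 : 0 < mu.

Lemma tail_functionE x : P (W 0%N @^-1` `]x, +oo[%classic) = (S x)%:E.
Proof. by rewrite /tail_function fineK// fin_num_measure. Qed.

Lemma integral_triangle_probability n (i j k : nat) :
  (0 < n)%N -> i != j -> j != k -> i != k ->
  (forall x, 0 < S x) ->
  measurable_fun [set: R] (scaled_quantile S (Num.sqrt n%:R)) ->
  (forall t, 0 <= scaled_quantile S (Num.sqrt n%:R) t) ->
  (forall x t, 0 <= x -> (x < scaled_quantile S (Num.sqrt n%:R) t) =
    (0 < t < S (Num.sqrt n%:R * x) / S (Num.sqrt n%:R))) ->
  (\int[P]_w (triangle_probability mu n (W i w) (W j w) (W k w))%:E =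
   (S (Num.sqrt n%:R) ^+ 3)%:E *
   \int[cube]_p triangle_profile mu (scaled_quantile S (Num.sqrt n%:R)) p)%E.
Proof.
move=> n0 ij jk ik S0 mq q0 lt_q; set s := Num.sqrt _.
have s0 : 0 < s by rewrite sqrtr_gt0 ltr0n.
have Ws0 (l : nat) (w : T) : 0 <= (W l w : R) / s by rewrite mulr_ge0// invr_ge0 ltW.
have mdiv : measurable_fun [set: R] (fun x : R => x / s) by exact: measurable_funM.
have mW l : measurable_fun [set: T] (fun w => W l w / s).
  by apply: (measurableT_comp mdiv).
have mW0 : @measurable_fun _ _ T (measurableTypeR R) [set: T] (fun w => W 0%N w / s).
  exact: mW.
(* The values are taken in [measurableTypeR R], so that the law lives on the same measurable space
   as Lebesgue measure. *)
pose X0 : {mfun T >-> measurableTypeR R} :=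
  HB.pack (fun w => W 0%N w / s) (isMeasurableFun.Build _ _ _ _ _ mW0).
pose nu : probability (measurableTypeR R) R := distribution P X0.
have mpre (A : set R) : measurable A -> measurable ((fun x => x / s) @^-1` A).
  by move=> mA; rewrite -[X in measurable X]setTI; exact: mdiv.
transitivity (\int[P]_w clipped_triangle mu (W i w / s, W j w / s, W k w / s)%R)%E.
  by apply: eq_integral => w _; rewrite triangle_probability_scale clipped_triangleE ?Ws0.
rewrite (@integral_joint_law _ _ T (measurableTypeR R) R P nu
  (fun w => W i w / s) (fun w => W j w / s) (fun w => W k w / s)).
- apply: triple_integral_law => // x x0.
  rewrite -tail_functionE /nu/= /distribution /pushforward; congr (P _).
  by apply/seteqP; split => w /=; rewrite !in_itv/= !andbT ltr_pdivlMr// [s * x]mulrC.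
- exact: mW.
- exact: mW.
- exact: mW.
- move=> A B C mA mB mC.
  by have := independent_triple W_iid ij jk ik (mpre _ mA) (mpre _ mB) (mpre _ mC).
- exact: measurable_clipped_triangle.
- exact: clipped_triangle_ge0.
Qed.

Lemma expected_trianglesE n (g : T -> rel 'I_n) (I : R) :
  (0 < n)%N -> weighted_random_graph W g ->
  (forall x, 0 < S x) ->
  measurable_fun [set: R] (scaled_quantile S (Num.sqrt n%:R)) ->
  (forall t, 0 <= scaled_quantile S (Num.sqrt n%:R) t) ->
  (forall x t, 0 <= x -> (x < scaled_quantile S (Num.sqrt n%:R) t) =
    (0 < t < S (Num.sqrt n%:R * x) / S (Num.sqrt n%:R))) ->
  (\int[cube]_p triangle_profile mu (scaled_quantile S (Num.sqrt n%:R)) p)%E = I%:E ->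
  expected_triangles P g = ('C(n, 3)%:R * (S (Num.sqrt n%:R) ^+ 3 * I))%:E.
Proof.
move=> n0 gW S0 mq q0 lt_q IE; apply: sum_over_triangles => t t3.
  have [i [j [k [ij jk ->]]]] := card3_sorted t3.
  by have [] := clique_probability gW ij jk.
have [i [j [k [ij jk ->]]]] := card3_sorted t3.
have [_ ->] := clique_probability gW ij jk.
rewrite integral_triangle_probability//.
- by rewrite EFinM IE.
- by rewrite ltn_eqF.
- by rewrite ltn_eqF.
- by rewrite ltn_eqF// (ltn_trans ij).
Qed.

End expected_triangles.

(** * The tail of the weights *)

Section tail_function_properties.
Context d (T : measurableType d) (R : realType) (P : probability T R).
Variable X : {RV P >-> R}.
Hypothesis X_ge0 : forall w, 0 <= X w.
Local Notation S := (tail_function X).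

Lemma ccdf_fin_num x : ccdf X x \is a fin_num.
Proof. by rewrite fin_num_measure. Qed.

Lemma tail_function_noninc : {homo S : x y /~ x <= y}.
Proof. by move=> x y xy; rewrite fine_le ?ccdf_fin_num// ccdf_nonincreasing. Qed.

Lemma tail_function_ge0 x : 0 <= S x.
Proof. by rewrite fine_ge0. Qed.

Lemma tail_function_le1 x : S x <= 1.
Proof. by rewrite -[leRHS]/(fine 1%:E) fine_le ?ccdf_fin_num// probability_le1. Qed.

Lemma tail_function_neg x : x < 0 -> S x = 1.
Proof.
move=> x0; rewrite /tail_function /ccdf /distribution /pushforward.
rewrite (_ : _ @^-1` _ = setT) ?probability_setT//.
by apply/seteqP; split => // w _ /=; rewrite in_itv/= andbT (lt_le_trans x0).
Qed.

Lemma tail_function_right x : S y @[y --> x^'+] --> S x.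
Proof.
apply: fine_cvg; rewrite fineK ?ccdf_fin_num//.
exact: ccdf_right_continuous.
Qed.

Lemma tail_function_cvg0 : S x @[x --> +oo] --> 0.
Proof. by apply: fine_cvg; exact: cvg_ccdfy0. Qed.

Lemma tail_function_regular alpha (L : R -> R) :
  slowly_varying L -> (forall x, 0 < x -> S x = x `^ (- alpha) * L x) ->
  forall x, 0 < x -> S (x * s) / S s @[s --> +oo] --> x `^ (- alpha).
Proof.
move=> L_slow SE x x0.
have Lx := L_slow _ x0; rewrite powRr0 in Lx.
have : x `^ (- alpha) * (L (x * s) / L s) @[s --> +oo] --> x `^ (- alpha) * 1.
  by apply: cvgMr.
rewrite mulr1; apply: cvg_trans; apply: near_eq_cvg; near=> s.
have s0 : 0 < s by near: s; exact: nbhs_pinfty_gt.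
rewrite !SE ?mulr_gt0// powRM ?(ltW x0) ?(ltW s0)//.
have sa : s `^ (- alpha) != 0 by rewrite gt_eqF// powR_gt0.
by rewrite invfM -!mulrA; congr (_ * _); rewrite [RHS]mulrCA mulVKf.
Unshelve. all: by end_near. Qed.

Variable alpha : R.
Hypothesis S_regular :
  forall x, 0 < x -> S (x * s) / S s @[s --> +oo] --> x `^ (- alpha).

(** If [S x] were 0, then [S] would vanish beyond [x] and the ratio at multiplier 1 would be 0 / 0 =
    0 eventually, contradicting its limit 1. *)
Lemma tail_function_gt0 x : 0 < S x.
Proof.
rewrite lt_def tail_function_ge0 andbT; apply/eqP => Sx0.
have c0 : S (1 * s) / S s @[s --> +oo] --> (0 : R).
  apply: (@cvg_trans _ ((fun=> 0 : R) @ +oo)); last exact: cvg_cst.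
  apply: near_eq_cvg; near=> s.
  have xs : x <= s by near: s; apply: nbhs_pinfty_ge; exact: num_real.
  have : S s <= 0 by rewrite -Sx0; exact: tail_function_noninc.
  rewrite le_eqVlt ltNge tail_function_ge0 orbF => /eqP ->.
  by rewrite invr0 mulr0.
have c1 := S_regular ltr01; rewrite powR1 in c1.
have : 0 = 1 :> R by exact: (cvg_unique _ c0 c1).
by move/eqP; rewrite eq_sym oner_eq0.
Unshelve. all: by end_near. Qed.

Hypothesis alpha_gt1 : 1 < alpha.
Local Notation leb := (@lebesgue_measure R).

(** Finiteness matters because [mean] would silently return 0 otherwise. In the layer-cake formula
    the tail is bounded by 1 up to [x0] and by a power of exponent [alpha - delta] = (alpha + 1) / 2
    > 1 beyond. *)
Lemma expectation_lty : ('E_P[X] < +oo)%E.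
Proof.
rewrite ge0_expectation_ccdf//.
have ccdfE r : ccdf X r = (S r)%:E by rewrite fineK ?ccdf_fin_num.
pose delta := (alpha - 1) / 2; have ha := alpha_gt1.
have da : 0 < delta < alpha by rewrite /delta; apply/andP; split; lra.
have S0 := tail_function_gt0.
have [C [x0 [C0 x00 HC]]] := potter_bound tail_function_noninc S0
  tail_function_le1 (S_regular (ltr0n _ 2)) da.
have b1 : 1 < alpha - delta by rewrite /delta; lra.
have a1 : 1 < alpha + delta by rewrite /delta; lra.
have mccdf (D : set R) : measurable_fun D (ccdf X).
  by apply: measurable_funTS; exact: ccdf_measurable.
rewrite (_ : `[0%R, +oo[%classic = `[0, x0]%classic `|` `]x0, +oo[%classic); last first.
  apply/seteqP; split => r /=; rewrite !in_itv/= !andbT.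
    by move=> r0; have [rx|rx] := leP r x0; [left; rewrite r0|right].
  by move=> [/andP[]//|/ltW]; apply: le_trans; exact: ltW.
rewrite ge0_integral_setU//=; last first.
  apply/disj_setPLR => r /=; rewrite !in_itv/= andbT => /andP[_ rx].
  by apply/negP; rewrite -leNgt.
- exact: mccdf.
apply: lte_add_pinfty.
  apply: (@le_lt_trans _ _ (\int[leb]_(r in `[0%R, x0]) cst 1 r)%E).
    apply: ge0_le_integral => //=; first exact: mccdf.
    by move=> r _; rewrite ccdfE lee_fin tail_function_le1.
  rewrite integral_cst//= mul1e lebesgue_measure_itv/= lte_fin x00 oppr0 adde0.
  exact: ltry.
(* The constant of the Potter bound at the fixed scale [x0] and argument [r / x0]. *)
pose K := C * S x0 * x0 `^ (alpha - delta).
have K0 : 0 <= K by rewrite !mulr_ge0 ?powR_ge0 ?(ltW C0) ?tail_function_ge0.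
have mp : measurable_fun `]x0, +oo[%classic (fun r : R => (r `^ (- (alpha - delta)))%:E).
  by apply/measurable_EFinP; apply: measurable_funTS; exact: measurable_powR.
apply: (@le_lt_trans _ _ (\int[leb]_(r in `]x0, +oo[) (K%:E * (r `^ (- (alpha - delta)))%:E))%E).
  apply: ge0_le_integral => //=.
  - exact: mccdf.
  - exact: emeasurable_funM.
  - move=> r; rewrite in_itv/= andbT => xr.
    have r0 : 0 < r by exact: lt_trans xr.
    have rx1 : 1 <= r / x0 by rewrite ler_pdivlMr// mul1r ltW.
    rewrite ccdfE -EFinM lee_fin.
    have := HC x0 (r / x0) (lexx _) (divr_gt0 r0 x00).
    rewrite mulrC divfK ?gt_eqF// => /le_trans; apply.
    rewrite max_r; last by apply: ler_powR => //; rewrite lerN2 lerD2l; lra.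
    rewrite /K -!mulrA ler_wpM2l ?(ltW C0)// ler_wpM2l ?tail_function_ge0//.
    rewrite powRM ?invr_ge0 ?(ltW r0) ?(ltW x00)// mulrC ler_wpM2r ?powR_ge0//.
    by rewrite -[x0^-1]powR_inv1 ?(ltW x00)// -powRrM mulN1r opprK.
rewrite ge0_integralZl//=.
- by rewrite lte_mul_pinfty ?lee_fin//; exact: integral_powR_tail.
- by move=> r _; rewrite lee_fin powR_ge0.
Qed.

(** The layer-cake integral over [0, 1] alone is at least [S 1 > 0]. *)
Lemma mean_gt0 : 0 < mean X.
Proof.
rewrite /mean fine_gt0// expectation_lty andbT.
have ccdfE r : ccdf X r = (S r)%:E by rewrite fineK ?ccdf_fin_num.
have mccdf (D : set R) : measurable_fun D (ccdf X).
  by apply: measurable_funTS; exact: ccdf_measurable.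
rewrite ge0_expectation_ccdf//.
apply: (@lt_le_trans _ _ (\int[leb]_(r in `[0%R, 1%R]) cst (S 1)%:E r)%E).
  rewrite integral_cst//= lebesgue_measure_itv/= lte_fin ltr01 oppr0 adde0.
  by rewrite mule1 lte_fin tail_function_gt0.
apply: (@le_trans _ _ (\int[leb]_(r in `[0%R, 1%R]) ccdf X r)%E).
  apply: ge0_le_integral => //=.
  - by move=> r _; rewrite lee_fin tail_function_ge0.
  - exact: mccdf.
  - move=> r; rewrite in_itv/= => /andP[_ r1]; rewrite ccdfE lee_fin.
    exact: tail_function_noninc.
apply: ge0_subset_integral => //=; first exact: mccdf.
by apply: subset_itvl.
Qed.

End tail_function_properties.

(** * Regular variation with varying multipliers, integer parts and binomials *)

Section regular_variation_tools.
Context {R : realType}.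

(** The multiplier [r i] moves with [i], while the hypothesis concerns fixed multipliers. Eventually
    [r i] lies between c - h' and c + h', monotonicity of [S] squeezes the ratio between those at
    these two fixed points, and continuity of the power makes their limits close. *)
Lemma cvg_regular_ratio (S : R -> R) (alpha c : R) {I : Type} {F : set_system I}
    {FF : ProperFilter F} (r s : I -> R) :
  {homo S : x y /~ x <= y} -> (forall x, 0 < S x) ->
  (forall x, 0 < x -> S (x * s) / S s @[s --> +oo] --> x `^ (- alpha)) ->
  0 < c -> r i @[i --> F] --> c -> s i @[i --> F] --> +oo ->
  S (r i * s i) / S (s i) @[i --> F] --> c `^ (- alpha).
Proof.
have squeeze (l a b x y z e : R) : `|l - a| < e / 2 -> `|l - b| < e / 2 ->
    `|a - y| < e / 2 -> `|b - z| < e / 2 -> x <= y -> z <= x -> `|l - x| < e.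
  rewrite !ltr_norml => /andP[? ?] /andP[? ?] /andP[? ?] /andP[? ?] ? ?.
  by apply/andP; split; lra.
move=> S_noninc S_gt0 S_reg c0 rc sy.
have cpow : {for c, continuous (@powR R ^~ (- alpha))}.
  apply/differentiable_continuous/derivable1_diffP.
  by apply: derivable_powR; rewrite in_itv/= c0.
apply/cvgrPdist_lt => e e0; have e20 : 0 < e / 2 by rewrite divr_gt0.
have /cvgrPdist_lt /(_ _ e20) /nbhs_ballP [h /= h0 hball] := cpow.
(* The halves give [h' < h], which keeps c - h' and c + h' in the continuity ball, and [h' < c],
   which keeps them positive. *)
pose h' := Num.min (h / 2) (c / 2).
have h'0 : 0 < h' by rewrite lt_min !divr_gt0.
have h'h : h' < h by rewrite (@le_lt_trans _ _ (h / 2)) ?ge_min ?lexx//; lra.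
have h'c : h' < c by rewrite (@le_lt_trans _ _ (c / 2)) ?ge_min ?lexx ?orbT//; lra.
have lo0 : 0 < c - h' by lra.
have hi0 : 0 < c + h' by lra.
have loP : `|c `^ (- alpha) - (c - h') `^ (- alpha)| < e / 2.
  by apply: hball; rewrite /ball/= opprB addrC subrK gtr0_norm.
have hiP : `|c `^ (- alpha) - (c + h') `^ (- alpha)| < e / 2.
  by apply: hball; rewrite /ball/= opprD addrA subrr add0r normrN gtr0_norm.
have limlo := cvg_comp _ _ sy (S_reg _ lo0).
have limhi := cvg_comp _ _ sy (S_reg _ hi0).
near=> i.
have s0 : 0 < s i by near: i; move/cvgryPgt : sy; exact.
have rlo : c - h' < r i by near: i; apply: (cvgr_gt _ rc); lra.
have rhi : r i < c + h' by near: i; apply: (cvgr_lt _ rc); lra.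
have Slo : S (r i * s i) / S (s i) <= S ((c - h') * s i) / S (s i).
  by rewrite ler_wpM2r ?invr_ge0 ?(ltW (S_gt0 _))// S_noninc// ler_wpM2r ?ltW.
have Shi : S ((c + h') * s i) / S (s i) <= S (r i * s i) / S (s i).
  by rewrite ler_wpM2r ?invr_ge0 ?(ltW (S_gt0 _))// S_noninc// ler_wpM2r ?ltW.
have Elo : `|(c - h') `^ (- alpha) - S ((c - h') * s i) / S (s i)| < e / 2.
  by near: i; exact: (cvgrPdist_lt _ _).1 limlo _ e20.
have Ehi : `|(c + h') `^ (- alpha) - S ((c + h') * s i) / S (s i)| < e / 2.
  by near: i; exact: (cvgrPdist_lt _ _).1 limhi _ e20.
exact: squeeze loP hiP Elo Ehi Slo Shi.
Unshelve. all: by end_near. Qed.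

Lemma cvg_truncn_ratio (lambda : R) : 0 < lambda ->
  (Num.truncn (lambda * x))%:R / (Num.truncn x)%:R @[x --> +oo] --> lambda.
Proof.
have base (c : R) : 0 < c -> (Num.truncn (c * x))%:R / x @[x --> +oo] --> c.
  move=> c0; apply: (@squeeze_cvgr _ _ _ _ (fun x : R => c - x^-1) (fun=> c)).
  - near=> x; have x0 : 0 < x by near: x; exact: nbhs_pinfty_gt.
    have /andP[t1 t2] := truncn_itv (mulr_ge0 (ltW c0) (ltW x0)).
    rewrite ler_pdivlMr// ler_pdivrMr// t1 andbT mulrBl mulVf ?gt_eqF//.
    by rewrite lerBlDr natr1 ltW.
  - rewrite -[X in _ --> X]subr0; apply: cvgB; first exact: cvg_cst.
    by rewrite gtr0_cvgV0; [exact: cvg_id|near=> x; near: x; exact: nbhs_pinfty_gt].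
  - exact: cvg_cst.
move=> lambda0; have b1 := base 1 ltr01; have bl := base _ lambda0.
have : (Num.truncn (lambda * x))%:R / x / ((Num.truncn (1 * x))%:R / x)
    @[x --> +oo] --> lambda / 1.
  by apply: cvgM => //; apply: cvgV => //; exact: oner_neq0.
rewrite divr1; apply: cvg_trans; apply: near_eq_cvg; near=> x.
have x0 : 0 < x by near: x; exact: nbhs_pinfty_gt.
by rewrite mul1r invfM invrK mulrACA mulVf ?mulr1 ?gt_eqF.
Unshelve. all: by end_near. Qed.

Lemma cvgy_truncn (lambda : R) : 0 < lambda ->
  Num.truncn (lambda * x) @[x --> +oo] --> \oo.
Proof.
move=> lambda0; apply/cvgnyPge => n; near=> x.
have x0 : 0 < x by near: x; exact: nbhs_pinfty_gt.
rewrite truncn_ge_nat; last by rewrite mulr_ge0 ?(ltW x0) ?(ltW lambda0).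
suff : lambda^-1 * n%:R <= x by rewrite ler_pdivrMl.
by near: x; apply: nbhs_pinfty_ge; exact: num_real.
Unshelve. all: by end_near. Qed.

Lemma binomial3E n : 6 * 'C(n, 3)%:R = n%:R * (n%:R - 1) * (n%:R - 2) :> R.
Proof.
rewrite mulrC -natrM (_ : 6 = 3`!)%N// bin_ffact.
case: n => [|[|n]]; rewrite ?ffact0n ?mul0r// !ffactnS ffactn0 muln1/=.
  by rewrite subrr mulr0 mul0r.
by rewrite !natrM -!natr1; ring.
Qed.

Lemma cvg_binomial3 : 6 * 'C(n, 3)%:R / n%:R ^+ 3 @[n --> \oo] --> (1 : R).
Proof.
have inv0 : (n%:R : R)^-1 @[n --> \oo] --> (0 : R).
  rewrite gtr0_cvgV0; first exact: cvgr_idn.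
  by near=> n; rewrite ltr0n; near: n; exact: nbhs_infty_gt.
have : (1 - n%:R^-1) * (1 - 2 * n%:R^-1) @[n --> \oo] --> (1 - 0) * (1 - 2 * 0 : R).
  apply: cvgM; apply: cvgB; [exact: cvg_cst|exact: inv0|exact: cvg_cst|].
  by apply: cvgMr.
rewrite mulr0 subr0 mulr1; apply: cvg_trans; apply: near_eq_cvg; near=> n.
have n2 : (2 <= n)%N by near: n; exact: nbhs_infty_ge.
have n0 : n%:R != 0 :> R by rewrite pnatr_eq0 -lt0n (ltn_trans _ n2).
rewrite binomial3E.
field.
exact: n0.
Unshelve. all: by end_near. Qed.

End regular_variation_tools.

Lemma cvgy_sqrt_nat (R : realType) : (Num.sqrt n%:R : R) @[n --> \oo] --> +oo.
Proof.
apply/cvgryPge => A; near=> n.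
apply: (le_trans (ler_norm A)); rewrite -sqrtr_sqr ler_sqrt//.
by near: n; exact: nbhs_infty_ger.
Unshelve. all: by end_near. Qed.

(** Source of the index: n^3 contributes lambda^3, and the three tails, evaluated at sqrt n, see the
    multiplier sqrt lambda. *)
Lemma powR_index (R : realType) (lambda alpha : R) : 0 < lambda ->
  lambda ^+ 3 * (Num.sqrt lambda `^ (- alpha)) ^+ 3 = lambda `^ (3 - 3 / 2 * alpha).
Proof.
move=> l0; rewrite -powR12_sqrt ?(ltW l0)// -powRrM -!powR_mulrn ?powR_ge0 ?(ltW l0)//.
rewrite -powRrM -powRD; last by rewrite (gt_eqF l0) implybT.
by congr (_ `^ _); field.
Qed.

Theorem lemma1p1 (R : realType) (d : measure_display) (T : measurableType d)
    (P : probability T R) (alpha : R) (L : R -> R)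
    (W : nat -> {RV P >-> R}) (G : forall n : nat, T -> rel 'I_n)
    (alpha_range : 1 < alpha < 2)
    (L_slow : slowly_varying L)
    (W_iid : iid W)
    (W_ge0 : forall (i : nat) (w : T), 0 <= W i w)
    (F_continuous : continuous (distribution_function (W 0%N)))
    (tailE : forall x : R, 0 < x -> tail_function (W 0%N) x = x `^ (- alpha) * L x)
    (G_graph : forall n : nat, weighted_random_graph W (G n)) :
  (exists eps : nat -> R,
     eps n @[n --> \oo] --> 0 /\
     \forall n \near \oo,
       expected_triangles P (G n) =
       ((1 + eps n)%:E * triangle_constant (mean (W 0%N)) alpha
        * (n%:R ^+ 3 * tail_function (W 0%N) (Num.sqrt n%:R) ^+ 3)%:E)%E) /\
  regularly_varying_seq (fun n : nat => fine (expected_triangles P (G n)))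
    (3 - 3 / 2 * alpha).
Proof.
have [a1 a2] := andP alpha_range.
have a0 : 0 < alpha by exact: lt_trans a1.
set S := tail_function (W 0%N); set mu := mean (W 0%N).
have S_reg : forall x, 0 < x -> S (x * s) / S s @[s --> +oo] --> x `^ (- alpha).
  exact: (tail_function_regular L_slow tailE).
have S_noninc : {homo S : x y /~ x <= y} by exact: tail_function_noninc.
have S_gt0 x : 0 < S x by exact: (tail_function_gt0 S_reg).
have S_le1 x : S x <= 1 by exact: tail_function_le1.
have S_neg x : x < 0 -> S x = 1 by apply: tail_function_neg; exact: W_ge0.
have S_right x : S y @[y --> x^'+] --> S x by exact: tail_function_right.
have S_cvg0 : S x @[x --> +oo] --> 0 by exact: tail_function_cvg0.
have mu_gt0 : 0 < mu by exact: (mean_gt0 (W_ge0 0%N) S_reg a1).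
pose sq n : R := Num.sqrt n%:R.
have [Jfin Icvg] := scaling_limit S_noninc S_gt0 S_le1 S_neg S_right S_cvg0 S_reg
  alpha_range mu_gt0 (@cvgy_sqrt_nat R).
have Jgt0 := limit_integral_gt0 alpha_range mu_gt0.
pose j := fine (limit_integral alpha mu).
have JE : limit_integral alpha mu = j%:E by rewrite fineK.
have j0 : 0 < j by rewrite -lte_fin -JE.
pose I n := fine (\int[square_measure (@lebesgue_measure R) \x lebesgue_measure]_p
  triangle_profile mu (scaled_quantile S (sq n)) p)%E.
rewrite JE in Icvg.
have Ij : I n @[n --> \oo] --> j by exact: fine_cvg.
have mE : \forall n \near \oo, expected_triangles P (G n) =
    ('C(n, 3)%:R * (S (sq n) ^+ 3 * I n))%:E.
  (* [I n] is defined through [fine], so it represents the integral only where the latter is finite;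
     convergence to a finite limit ensures this eventually. *)
  have Ifin := cvg_is_fine Icvg.
  near=> n; have n0 : (0 < n)%N by near: n; exact: nbhs_infty_gt.
  have s0 : 0 < sq n by rewrite sqrtr_gt0 ltr0n.
  apply: (expected_trianglesE W_iid W_ge0 mu_gt0 n0 (G_graph n) S_gt0).
  - exact: measurable_scaled_quantile.
  - by move=> t; exact: scaled_quantile_ge0.
  - by move=> x t x0; exact: lt_scaled_quantile.
  - by rewrite fineK//; near: n.
(* All corrections to n^3 S(sqrt n)^3 / 6 are gathered in [k], whose limit is the limit integral
   [j]. *)
pose k n := 6 * 'C(n, 3)%:R / n%:R ^+ 3 * I n.
have kj : k n @[n --> \oo] --> j.
  by rewrite -[j]mul1r; apply: cvgM => //; exact: cvg_binomial3.
have mkE : \forall n \near \oo, expected_triangles P (G n) =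
    (k n / 6 * (n%:R ^+ 3 * S (sq n) ^+ 3))%:E.
  near=> n; have n0 : n%:R != 0 :> R.
    by rewrite pnatr_eq0 -lt0n; near: n; exact: nbhs_infty_gt.
  have -> : expected_triangles P (G n) = ('C(n, 3)%:R * (S (sq n) ^+ 3 * I n))%:E.
    by near: n.
  by congr EFin; rewrite /k; field.
clearbody k.
split.
  (* The constant is [j / 6], so 1 + eps n has to be [k n / j]; dividing uses positivity of [j]. *)
  exists (fun n => k n / j - 1); split.
    rewrite -(subrr (1 : R)); apply: cvgB; last exact: cvg_cst.
    by rewrite -(mulfV (lt0r_neq0 j0)); exact: cvgMl.
  apply: filterS mkE => n ->.
  rewrite triangle_constantE// JE -!EFinM; congr EFin.
  by rewrite addrCA subrr addr0; field; rewrite gt_eqF.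
move=> lambda lambda0.
pose N x := Num.truncn (x : R); pose N' x := Num.truncn (lambda * x).
have Ny : N x @[x --> +oo] --> \oo.
  have -> : N = (fun x => Num.truncn (1 * x)) by apply/funext => x; rewrite mul1r.
  exact: cvgy_truncn.
have N'y : N' x @[x --> +oo] --> \oo by exact: cvgy_truncn.
(* Chosen so that [r x * sq (N x) = sq (N' x)]: integer parts make the ratio of the two scales only
   asymptotic to sqrt lambda, hence the version with a moving multiplier. *)
pose r x := Num.sqrt ((N' x)%:R / (N x)%:R) : R.
have rl : r x @[x --> +oo] --> Num.sqrt lambda.
  by apply: (cvg_comp _ _ (cvg_truncn_ratio lambda0)); exact: sqrt_continuous.
have sy : sq (N x) @[x --> +oo] --> +oo.
  exact: (cvg_comp _ _ Ny (@cvgy_sqrt_nat R)).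
have Slim : S (r x * sq (N x)) / S (sq (N x)) @[x --> +oo] --> Num.sqrt lambda `^ (- alpha).
  by apply: cvg_regular_ratio => //; rewrite sqrtr_gt0.
have kN : k (N x) @[x --> +oo] --> j by exact: (cvg_comp _ _ Ny kj).
have kN' : k (N' x) @[x --> +oo] --> j by exact: (cvg_comp _ _ N'y kj).
have cube (f : R -> R) (l : R) : f x @[x --> +oo] --> l ->
    f x ^+ 3 @[x --> +oo] --> l ^+ 3.
  by move=> fl; exact: (cvg_comp _ _ fl (@exprn_continuous R 3 l)).
have klim : k (N' x) / k (N x) @[x --> +oo] --> j / j.
  exact: (cvgM kN' (cvgV (lt0r_neq0 j0) kN)).
have : k (N' x) / k (N x) * (((N' x)%:R / (N x)%:R) ^+ 3
    * (S (r x * sq (N x)) / S (sq (N x))) ^+ 3)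
    @[x --> +oo] --> j / j * (lambda ^+ 3 * (Num.sqrt lambda `^ (- alpha)) ^+ 3).
  exact: (cvgM klim (cvgM (cube _ _ (cvg_truncn_ratio lambda0)) (cube _ _ Slim))).
rewrite mulfV ?gt_eqF// mul1r powR_index//; apply: cvg_trans; apply: near_eq_cvg.
have mkN := Ny _ mkE; have mkN' := N'y _ mkE.
have N_gt0 : \forall x \near +oo, (0 < N x)%N by exact: (Ny _ (nbhs_infty_gt 0)).
have kN_neq0 : \forall x \near +oo, k (N x) != 0.
  exact: (cvgr_neq0 _ kN (lt0r_neq0 j0)).
near=> x.
have Nx0 : (N x)%:R != 0 :> R.
  by rewrite pnatr_eq0 -lt0n; near: x.
rewrite -/(N x) -/(N' x).
have -> : expected_triangles P (G (N x)) =
    (k (N x) / 6 * ((N x)%:R ^+ 3 * S (sq (N x)) ^+ 3))%:E by near: x.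
have -> : expected_triangles P (G (N' x)) =
    (k (N' x) / 6 * ((N' x)%:R ^+ 3 * S (sq (N' x)) ^+ 3))%:E by near: x.
have -> : r x * sq (N x) = sq (N' x).
  by rewrite /r /sq -sqrtrM ?divr_ge0// divfK.
rewrite /=; field.
rewrite Nx0 (gt_eqF (S_gt0 _))/=.
by near: x.
Unshelve. all: by end_near. Qed.
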